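(* Let $n\ge 3$, let $(A,\Lambda)$ be a form ring and let $(I,\Gamma)$, $(J,\Delta)$ be two form ideals of $(A,\Lambda)$. Then the mixed commutator subgroup $\big[\mathrm{EU}(2n,I,\Gamma),\mathrm{EU}(2n,J,\Delta)\big]$ is generated as a group by the elements of the form (1) ${}^{c}\big[T_{ji}(\alpha),{}^{T_{ij}(a)}T_{ji}(\beta)\big]$, (2) ${}^{c}\big[T_{ji}(\alpha),T_{ij}(\beta)\big]$, (3) ${}^{c}T_{ij}(\xi)$, where $T_{ji}(\alpha)\in\mathrm{EU}(2n,I,\Gamma)$; $T_{ji}(\beta)\in\mathrm{EU}(2n,J,\Delta)$ in (1) and $T_{ij}(\beta)\in\mathrm{EU}(2n,J,\Delta)$ in (2); $T_{ij}(\xi)\in\mathrm{EU}\big(2n,(I,\Gamma)\circ(J,\Delta)\big)$; and $T_{ij}(a),c\in\mathrm{EU}(2n,A,\Lambda)$, with $i\neq j$ ranging over all pairs of indices.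
   Context: Form rings. $A$ is an associative (not necessarily commutative) ring with $1$ with an involution $a\mapsto\bar a$ (additive, $\overline{ab}=\bar b\bar a$, $\bar{\bar a}=a$). Fix $\lambda\in\mathrm{Cent}(A)$ with $\lambda\bar\lambda=1$. Put $\Lambda_{\min}=\{a-\lambda\bar a: a\in A\}$, $\Lambda_{\max}=\{a\in A: a=-\lambda\bar a\}$. A form parameter is an additive subgroup $\Lambda$ with $\Lambda_{\min}\subseteq\Lambda\subseteq\Lambda_{\max}$ and $a\Lambda\bar a\subseteq\Lambda$ for all $a\in A$; $(A,\Lambda)$ is then a form ring. Form ideals. For a two-sided ideal $I$ with $\bar I=I$ put $\Gamma_{\max}(I)=I\cap\Lambda$ and $\Gamma_{\min}(I)=\{\xi-\lambda\bar\xi:\xi\in I\}+\langle\xi\alpha\bar\xi:\xi\in I,\alpha\in\Lambda\rangle$ ($\langle\cdot\rangle$ = additive subgroup generated). A relative form parameter of level $I$ is an additive subgroup $\Gamma$ with $\Gamma_{\min}(I)\subseteq\Gamma\subseteq\Gamma_{\max}(I)$ and $a\Gamma\bar a\subseteq\Gamma$ for all $a\in A$; then $(I,\Gamma)$ is a form ideal. The symmetrised product of form ideals is $$(I,\Gamma)\circ(J,\Delta)=\big(IJ+JI,\ \Gamma_{\min}(IJ+JI)+{}^J\Gamma+{}^I\Delta\big),$$ where ${}^J\Gamma=\langle\xi\gamma\bar\xi:\xi\in J,\gamma\in\Gamma\rangle$ and ${}^I\Delta=\langle\xi\delta\bar\xi:\xi\in I,\delta\in\Delta\rangle$. Elementary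 groups. Index rows and columns of $2n\times 2n$ matrices by $\{1,\dots,n,-n,\dots,-1\}$, with $\varepsilon(i)=1$ for $i>0$ and $\varepsilon(i)=-1$ for $i<0$. Elementary unitary transvections in $\mathrm{GL}(2n,A)$: for $i\ne\pm j$ and $\xi\in A$, $T_{ij}(\xi)=e+\xi e_{ij}-\lambda^{(\varepsilon(j)-\varepsilon(i))/2}\bar\xi e_{-j,-i}$; and for $\alpha\in\lambda^{-(\varepsilon(i)+1)/2}\Lambda$, $T_{i,-i}(\alpha)=e+\alpha e_{i,-i}$. $\mathrm{EU}(2n,A,\Lambda)$ is the group generated by all of them. $\mathrm{FU}(2n,I,\Gamma)$ is generated by $T_{ij}(\xi)$ with $\xi\in I$ if $i\ne\pm j$ and $\xi\in\lambda^{-(\varepsilon(i)+1)/2}\Gamma$ if $i=-j$. $\mathrm{EU}(2n,I,\Gamma)$, also written $\mathrm{EU}(2n,(I,\Gamma))$, is the normal closure of $\mathrm{FU}(2n,I,\Gamma)$ in $\mathrm{EU}(2n,A,\Lambda)$. Commutators. ${}^xy=xyx^{-1}$, $[x,y]=xyx^{-1}y^{-1}$; for subgroups $H,K$, $[H,K]$ is the subgroup generated by all $[x,y]$, $x\in H$, $y\in K$. *)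

(* Defs.v *)
From HB Require Import structures.
From mathcomp Require Import all_boot all_order all_algebra.
From mathcomp Require Import boolp classical_sets.

Set Implicit Arguments.
Unset Strict Implicit.
Unset Printing Implicit Defensive.

Import GRing.Theory.
Local Open Scope classical_set_scope.
Local Open Scope ring_scope.

(* Additive subgroups, sums and two-sided ideals, as subsets (a form parameter
   or an ideal need not be decidable). *)
Section AdditiveSubgroups.
Variable V : zmodType.

Definition additive_subgroup (S : set V) : Prop :=
  S 0 /\ (forall x y : V, S x -> S y -> S (x - y)).

Definition additive_span (S : set V) : set V := smallest additive_subgroup S.

Definition set_add (S T : set V) : set V := [set x + y | x in S & y in T].

End AdditiveSubgroups.

Definition two_sided_ideal (R : pzRingType) (I : set R) : Prop :=
  additive_subgroup I /\ (forall a x : R, I x -> I (a * x) /\ I (x * a)).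

(* The product IJ of ideals consists of finite sums of products. *)
Definition ideal_mul (R : pzRingType) (I J : set R) : set R :=
  additive_span [set x * y | x in I & y in J].

Section FormParameters.
Variables (A : pzRingType) (bar : A -> A) (lam : A).

Definition ring_involution : Prop :=
  [/\ {morph bar : a b / a + b}, {morph bar : a b / a * b >-> b * a}
    & involutive bar].

Definition Lambda_min : set A := [set a - lam * bar a | a in setT].

Definition Lambda_max : set A := [set a | a = - (lam * bar a)].

Definition form_parameter (L : set A) : Prop :=
  [/\ additive_subgroup L, Lambda_min `<=` L, L `<=` Lambda_max
    & forall a x : A, L x -> L (a * x * bar a)].

End FormParameters.

Record formRing := FormRing {
  form_carrier :> pzRingType;
  bar : form_carrier -> form_carrier;
  lam : form_carrier;
  Lam : set form_carrier;
  barP : ring_involution bar;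
  lam_central : forall a : form_carrier, lam * a = a * lam;
  lam_unitary : lam * bar lam = 1;
  LamP : form_parameter bar lam Lam
}.

Arguments Lam : clear implicits.
Arguments lam : clear implicits.

Section FormIdeals.
Variable A : formRing.
Implicit Types I J G D : set A.

Definition Gamma_max I : set A := I `&` Lam A.

(* [conj_span I G] is the additive subgroup ^I G. *)
Definition conj_span I G : set A :=
  additive_span [set xi * g * bar xi | xi in I & g in G].

Definition Gamma_min I : set A :=
  set_add [set xi - lam A * bar xi | xi in I] (conj_span I (Lam A)).

Definition relative_form_parameter I G : Prop :=
  [/\ additive_subgroup G, Gamma_min I `<=` G, G `<=` Gamma_max I
    & forall a x : A, G x -> G (a * x * bar a)].

Definition form_ideal (P : set A * set A) : Prop :=
  [/\ two_sided_ideal P.1, (@bar A) @` P.1 = P.1 & relative_form_parameter P.1 P.2].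

Definition form_ideal_mul (P Q : set A * set A) : set A * set A :=
  let K := set_add (ideal_mul P.1 Q.1) (ideal_mul Q.1 P.1) in
  (K, set_add (set_add (Gamma_min K) (conj_span Q.1 P.2)) (conj_span P.1 Q.2)).

End FormIdeals.

Section Subgroups.
Variable G : groupType.
Local Open Scope group_scope.

Definition subgroup (H : set G) : Prop :=
  [/\ H 1, forall x y : G, H x -> H y -> H (x * y)
    & forall x : G, H x -> H x^-1].

Definition generated (S : set G) : set G := smallest subgroup S.

(* Left-handed conventions, unlike [conjg] and [commg]. *)
Definition lconj (x y : G) : G := x * y * x^-1.
Definition lcomm (x y : G) : G := x * y * x^-1 * y^-1.

Definition mixed_commutator (H K : set G) : set G :=
  generated [set lcomm x y | x in H & y in K].

Definition normal_subgroup (K N : set G) : Prop :=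
  [/\ subgroup N, N `<=` K & forall x y : G, K x -> N y -> N (lconj x y)].

Definition normal_closure (K S : set G) : set G :=
  smallest (normal_subgroup K) S.

End Subgroups.

(* GL(m, R) over a possibly noncommutative ring: a matrix together with its
   (necessarily unique) two-sided inverse. *)
Section GeneralLinear.
Variables (R : pzRingType) (m : nat).

Record GL := MkGL {
  gl_pair : 'M[R]_m * 'M[R]_m;
  gl_pairP : (gl_pair.1 *m gl_pair.2 == 1%:M) && (gl_pair.2 *m gl_pair.1 == 1%:M)
}.

HB.instance Definition _ := [isSub for gl_pair].
HB.instance Definition _ := [Choice of GL by <:].

Definition gl_mx (x : GL) : 'M[R]_m := (val x).1.

Lemma gl_mulP (x y : GL) :
  let p := ((val x).1 *m (val y).1, (val y).2 *m (val x).2) in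
  (p.1 *m p.2 == 1%:M) && (p.2 *m p.1 == 1%:M).
Proof.
case: x y => [[x x'] /= /andP[/eqP xx' /eqP x'x]].
case=> [[y y'] /= /andP[/eqP yy' /eqP y'y]].
by rewrite !mulmxA -(mulmxA x) yy' mulmx1 xx' -(mulmxA y') x'x mulmx1 y'y !eqxx.
Qed.

Lemma gl_oneP :
  let p := (1%:M, 1%:M) : 'M[R]_m * 'M[R]_m in
  (p.1 *m p.2 == 1%:M) && (p.2 *m p.1 == 1%:M).
Proof. by rewrite /= mulmx1 eqxx. Qed.

Lemma gl_invP (x : GL) :
  let p := ((val x).2, (val x).1) in
  (p.1 *m p.2 == 1%:M) && (p.2 *m p.1 == 1%:M).
Proof. by case: x => [[x x'] /= /andP[-> ->]]. Qed.

Definition gl_mul (x y : GL) : GL := MkGL (gl_mulP x y).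
Definition gl_one : GL := MkGL gl_oneP.
Definition gl_inv (x : GL) : GL := MkGL (gl_invP x).

Lemma gl_mulA : associative gl_mul.
Proof. by move=> x y z; apply: val_inj; rewrite /= !mulmxA. Qed.

Lemma gl_mul1 : left_id gl_one gl_mul.
Proof.
by move=> x; apply: val_inj; rewrite /= mul1mx mulmx1; case: (gl_pair x).
Qed.

Lemma gl_mulr1 : right_id gl_one gl_mul.
Proof.
by move=> x; apply: val_inj; rewrite /= mul1mx mulmx1; case: (gl_pair x).
Qed.

Lemma gl_mulV : left_inverse gl_one gl_inv gl_mul.
Proof.
by move=> x; apply: val_inj; rewrite /=; case: x => [[x x'] /= /andP[_ /eqP ->]].
Qed.

Lemma gl_mulrV : right_inverse gl_one gl_inv gl_mul.
Proof.
by move=> x; apply: val_inj; rewrite /=; case: x => [[x x'] /= /andP[/eqP -> _]].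
Qed.

HB.instance Definition _ :=
  isGroup.Build GL gl_mulA gl_mul1 gl_mulr1 gl_mulV gl_mulrV.

Lemma gl_mx_inj : injective gl_mx.
Proof.
move=> [[x x'] p] [[y y'] q]; rewrite /gl_mx /= => exy; apply: val_inj => /=.
move: p q; rewrite -{y}exy /= => /andP[_ /eqP x'x] /andP[/eqP xy' _].
by congr pair; rewrite -[x']mulmx1 -xy' mulmxA x'x mul1mx.
Qed.

End GeneralLinear.

(* The index set 1, ..., n, -n, ..., -1, in this order, is 'I_(2 * n): the
   ordinal k stands for k + 1 if k < n and for k - 2n otherwise, so that
   i |-> -i is [rev_ord]. *)
Section ElementaryUnitary.
Variables (A : formRing) (n : nat).
Implicit Types (i j : 'I_(2 * n)) (xi : A) (P : set A * set A).

Definition eps i : int := if (i < n)%N then 1 else -1.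

(* Integral powers of lam, whose inverse is bar lam. *)
Definition lam_pow (k : int) : A :=
  match k with Posz m => lam A ^+ m | Negz m => bar (lam A) ^+ m.+1 end.

(* The matrix of T_ij(xi); only meaningful for i != j. *)
Definition transv_mx i j xi : 'M[A]_(2 * n) :=
  if j == rev_ord i then 1%:M + xi *: delta_mx i j
  else 1%:M + xi *: delta_mx i j
       - (lam_pow ((eps j - eps i) %/ 2)%Z * bar xi)
           *: delta_mx (rev_ord j) (rev_ord i).

(* T_ij(xi) as an element of GL(2n, A), with inverse T_ij(-xi). For i != j the
   default value is never reached, by [gl_mx_transv]. *)
Definition transv i j xi : GL A (2 * n) :=
  insubd (gl_one A (2 * n)) (transv_mx i j xi, transv_mx i j (- xi)).

Lemma barN xi : bar (- xi) = - bar xi.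
Proof.
have [barD _ _] := barP A.
have bar0 : bar (0 : A) = 0 by apply: (addIr (bar 0)); rewrite -barD !add0r.
by apply: (addIr (bar xi)); rewrite -barD !addNr.
Qed.

Lemma rev_ord_neq i : rev_ord i != i.
Proof.
apply/eqP => /(congr1 val) /= e.
have := subnK (ltn_ord i); rewrite e => /(congr1 odd).
by rewrite addnS oddS oddD addbb mul2n odd_double.
Qed.

Lemma transv_mxK i j xi : i != j ->
  transv_mx i j xi *m transv_mx i j (- xi) = 1%:M.
Proof.
move=> ij; rewrite /transv_mx barN.
have key (N : 'M[A]_(2 * n)) : N *m N = 0 -> (1%:M + N) *m (1%:M - N) = 1%:M.
  by move=> N2; rewrite mulmxDl !mulmxBr !mul1mx mulmx1 N2 subr0 subrK.
have dd (a b : A) (k l p q : 'I_(2 * n)) : l != p ->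
    (a *: delta_mx k l) *m (b *: delta_mx p q) = 0 :> 'M[A]_(2 * n).
  move=> lp; apply/matrixP => u v; rewrite !mxE big1 // => w _; rewrite !mxE.
  have [-> | _] := eqVneq w l; last by rewrite andbF mulr0 mul0r.
  by rewrite (negbTE lp) /= !mulr0.
case: ifP => [_ | /negbT jNi].
  by rewrite scaleNr key // dd // eq_sym.
rewrite scaleNr mulrN scaleNr opprK -addrA.
set X := xi *: _; set Y := _ *: delta_mx (rev_ord j) _.
rewrite -addrA -[- X + Y]opprK opprD opprK key //.
rewrite mulmxBl !mulmxBr !dd ?subr0 //.
- by rewrite (inj_eq rev_ord_inj).
- exact: rev_ord_neq.
- by rewrite eq_sym rev_ord_neq.
- by rewrite eq_sym.
Qed.

Lemma gl_mx_transv i j xi : i != j -> gl_mx (transv i j xi) = transv_mx i j xi.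
Proof.
move=> ij; rewrite /gl_mx /transv val_insubd /=.
by have:= transv_mxK (- xi) ij; rewrite opprK => ->; rewrite transv_mxK // !eqxx.
Qed.

(* The parameters allowed in T_ij for a pair (I, Gamma). *)
Definition params P i j : set A :=
  if j == rev_ord i then [set lam_pow (- ((eps i + 1) %/ 2)%Z) * x | x in P.2]
  else P.1.

Definition FU P : set (GL A (2 * n)) :=
  generated [set g | exists i j xi, [/\ i != j, params P i j xi
                                      & g = transv i j xi]].

Definition EU_abs : set (GL A (2 * n)) := FU (setT, Lam A).

Definition EU P : set (GL A (2 * n)) := normal_closure EU_abs (FU P).

(* [transv_in H i j] is the set of the xi for which T_ij(xi) is an elementary
   unitary transvection lying in H. *)
Definition transv_in (H : set (GL A (2 * n))) i j : set A :=
  [set xi | params (setT, Lam A) i j xi /\ H (transv i j xi)].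

End ElementaryUnitary.

Arguments FU {A} n P.
Arguments EU_abs : clear implicits.
Arguments EU {A} n P.

(* Main.v *)
Require Import Defs.
From mathcomp Require Import all_boot all_order all_algebra.
From mathcomp Require Import boolp classical_sets.
From mathcomp Require Import zify.

(** Every generator on the right lies in the mixed commutator subgroup: those
    of the first two kinds are conjugates of commutators, and a root element
    whose parameter has the level of the symmetrised product is a product of
    commutators of root elements of the two levels, by the Steinberg relations
    ([mem_product]).

    For the other inclusion let [M] be the subgroup on the right, which is
    normal in [EU(2n, A, Lam)]. The relative group [EU(2n, J, Delta)] is
    generated, as a group, by the elementary conjugates [T_ji(a) T_ij(b)
    T_ji(- a)] with [b] of level [(J, Delta)] ([rootEU_conjugates]). By
    normality of [M] it is therefore enough that the commutator of a root
    element [T_r] of level [(I, Gamma)] with such a conjugate at a root [s]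
    lies in [M] ([lcomm_root_conjugate]). If [r = s] or [r = - s] it is, up to
    conjugation, a generator of the first or second kind. Otherwise some
    linear form on the root lattice vanishes at [s] and is positive at [r]
    ([separating_weight]). The root elements at positive roots generate a
    unipotent radical, which the root elements at [s] and [- s] normalise; so
    the conjugation can be moved onto [T_r], and the Chevalley commutator
    formula ([lcomm_radical]) expresses the commutator by root elements of the
    product level, which are generators of the third kind.

    The same formula proves most of the generation statement, where
    conjugation by [T_r] of an elementary conjugate at [s] has to be
    controlled. The exception is [r = s] ([mem_conjugate_same]): there the
    root element is first written by means of a commutator of elements at
    roots not proportional to [s], for which another index is used.

    All of this takes place in an arbitrary group with root elements that
    satisfy the Steinberg relations ([steinberg]); the matrices are only used
    to verify these relations ([transv_steinberg]). *)

Set Implicit Arguments.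
Unset Strict Implicit.
Unset Printing Implicit Defensive.

Import Order.TTheory GRing.Theory Num.Theory.
Local Open Scope classical_set_scope.

(** * Conjugates, commutators and generated subgroups *)

Section GroupWords.
Variable G : groupType.
Local Open Scope group_scope.
Implicit Types (x y c : G) (S M H K : set G).

Lemma lconjM c x y : lconj c (x * y) = lconj c x * lconj c y.
Proof. by rewrite /lconj !mulgA mulgVK. Qed.

Lemma lconjJ c d x : lconj (c * d) x = lconj c (lconj d x).
Proof. by rewrite /lconj invgM !mulgA. Qed.

Lemma lconjV c x : lconj c x^-1 = (lconj c x)^-1.
Proof. by rewrite /lconj !invgM invgK !mulgA. Qed.

Lemma lconj1 x : lconj 1 x = x.
Proof. by rewrite /lconj invg1 mulg1 mul1g. Qed.

Lemma lconjg1 c : lconj c 1 = 1.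
Proof. by rewrite /lconj mulg1 mulgV. Qed.

Lemma lconjVK c x : lconj c (lconj c^-1 x) = x.
Proof. by rewrite -lconjJ mulgV lconj1. Qed.

Lemma lcommV x y : (lcomm x y)^-1 = lcomm y x.
Proof. by rewrite /lcomm !invgM !invgK !mulgA. Qed.

Lemma lcommMl x x' y : lcomm (x * x') y = lconj x (lcomm x' y) * lcomm x y.
Proof. by rewrite /lconj /lcomm !invgM !mulgA !mulgVK. Qed.

Lemma lcommVl x y : lcomm x^-1 y = lconj x^-1 (lcomm x y)^-1.
Proof.
by rewrite /lconj /lcomm !invgM !invgK !mulgA mulgVK.
Qed.

Lemma lconj_lcomm c x y : lconj c (lcomm x y) = lcomm (lconj c x) (lconj c y).
Proof. by rewrite /lcomm !lconjM !lconjV. Qed.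

Lemma lconjE x y : lconj x y = lcomm x y * y.
Proof. by rewrite /lconj /lcomm mulgVK. Qed.

Lemma lcomm_lconjr x y : lcomm x y = x * lconj y x^-1.
Proof. by rewrite /lconj /lcomm !mulgA. Qed.

Lemma lcomm_lconjl x y : lcomm x y = lconj x y * y^-1.
Proof. by []. Qed.

Lemma lcomm_swap x y : x * y = lcomm x y * y * x.
Proof. by rewrite /lcomm !mulgVK. Qed.

Lemma generated_subgroup S : subgroup (generated S).
Proof.
split=> [H [[]] // | x y Sx Sy H HS | x Sx H HS].
- by have [[_ HM _] _] := HS; apply: HM; [apply: Sx | apply: Sy].
- by have [[_ _ HV] _] := HS; apply: HV; apply: Sx.
Qed.

Lemma generated_min S H : subgroup H -> S `<=` H -> generated S `<=` H.
Proof. exact: smallest_sub. Qed.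

Lemma generated_mono S S' : S `<=` S' -> generated S `<=` generated S'.
Proof.
move=> SS'; apply: generated_min; first exact: generated_subgroup.
by apply: subset_trans SS' _; apply: sub_gen_smallest.
Qed.

Lemma mem_generated S x : S x -> generated S x.
Proof. exact: sub_gen_smallest. Qed.

Definition normalizes H c := forall x, H x -> H (lconj c x).

Lemma lconj_generated S H c : subgroup H -> (forall x, S x -> H (lconj c x)) ->
  forall x, generated S x -> H (lconj c x).
Proof.
move=> [H1 HM HV] cS; apply: (@generated_min S [set x | H (lconj c x)]) => //.
split=> [|x y Hx Hy|x Hx] /=; first by rewrite lconjg1.
- by rewrite lconjM; apply: HM.
- by rewrite lconjV; apply: HV.
Qed.

Lemma normalizes_generated S H : (forall x, S x -> S x^-1) ->
  (forall x, S x -> normalizes H x) ->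
  forall c, generated S c -> normalizes H c.
Proof.
move=> SV SH c Sc.
suff [] : normalizes H c /\ normalizes H c^-1 by [].
move: c Sc.
apply: (@generated_min S [set c | normalizes H c /\ normalizes H c^-1]).
  split=> [|x y [Hx Hx'] [Hy Hy']|x [Hx Hx']] /=.
  - by rewrite invg1; split=> x; rewrite lconj1.
  - by rewrite invgM; split=> z Hz; rewrite lconjJ; auto.
  - by rewrite invgK.
by move=> x Sx; split; apply: SH => //; apply: SV.
Qed.

(** The elements that commute with [y] modulo [M] form a group as soon as they
    normalise [M], because [xx', y] is the product of a conjugate of [x', y]
    by [x] and of [x, y]. *)
Lemma lcomm_generated S M y : subgroup M ->
  (forall x, generated S x -> normalizes M x) ->
  (forall x, S x -> M (lcomm x y)) -> forall x, generated S x -> M (lcomm x y).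
Proof.
move=> [M1 MM MV] nM SM.
have [S1 SMl SV] := generated_subgroup S.
suff: generated S `<=` [set x | generated S x /\ M (lcomm x y)].
  by move=> sub x /sub[].
apply: generated_min; last by move=> x Sx; split; [apply: mem_generated | auto].
split=> [|x x' [Sx Mx] [Sx' Mx']|x [Sx Mx]] /=.
- by split=> //; rewrite lcomm_lconjr lconjV lconjg1 invg1 mulg1.
- split; first exact: SMl.
  by rewrite lcommMl; apply: MM => //; apply: nM.
- split; first exact: SV.
  by rewrite lcommVl; apply: nM; [apply: SV | apply: MV].
Qed.

Lemma normal_closure_normal K S : subgroup K -> S `<=` K ->
  normal_subgroup K (normal_closure K S).
Proof.
move=> [K1 KM KV] SK; split; first split.
- by move=> N [[[]]].
- move=> x y Nx Ny N NS; have [[[_ NM _] _ _] _] := NS.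
  by apply: NM; [apply: Nx | apply: Ny].
- move=> x Nx N NS; have [[[_ _ NV] _ _] _] := NS.
  by apply: NV; apply: Nx.
- apply: smallest_sub => //; split=> // x y Kx Ky.
  by apply: (KM) => //; [apply: KM | apply: KV].
- move=> x y Kx Ny N NS; have [[_ _ NJ] _] := NS.
  by apply: NJ => //; apply: Ny.
Qed.

End GroupWords.

Local Open Scope ring_scope.

(** * Additive subgroups *)

Section AdditiveSpan.
Variable V : zmodType.
Implicit Types S H : set V.

Lemma additive_subgroupN S x : additive_subgroup S -> S x -> S (- x).
Proof. by case=> S0 SB Sx; rewrite -sub0r; apply: SB. Qed.

Lemma additive_subgroupD S x y :
  additive_subgroup S -> S x -> S y -> S (x + y).
Proof.
move=> aS Sx Sy; rewrite -[y]opprK.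
by apply: (aS.2) => //; apply: additive_subgroupN.
Qed.

Lemma additive_span_subgroup S : additive_subgroup (additive_span S).
Proof.
split=> [H [[]] // | x y Sx Sy H HS].
by have [[_ HB] _] := HS; apply: HB; [apply: Sx | apply: Sy].
Qed.

Lemma additive_span_min S H :
  additive_subgroup H -> S `<=` H -> additive_span S `<=` H.
Proof. exact: smallest_sub. Qed.

Lemma mem_additive_span S x : S x -> additive_span S x.
Proof. exact: sub_gen_smallest. Qed.

Lemma set_add_subgroup S S' : additive_subgroup S -> additive_subgroup S' ->
  additive_subgroup (set_add S S').
Proof.
move=> [S0 SB] [S'0 S'B]; split.
  by exists 0 => //; exists 0; rewrite ?addr0.
move=> _ _ [x Sx [y S'y <-]] [z Sz [t S't <-]].
exists (x - z); first exact: SB.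
by exists (y - t); [exact: S'B | rewrite opprD addrACA].
Qed.

Lemma set_addl S S' x : additive_subgroup S' -> S x -> set_add S S' x.
Proof. by case=> S'0 _ Sx; exists x => //; exists 0; rewrite ?addr0. Qed.

Lemma set_addr S S' x : additive_subgroup S -> S' x -> set_add S S' x.
Proof. by case=> S0 _ Sx; exists 0 => //; exists x; rewrite ?add0r. Qed.

Lemma set_add_min S S' H : additive_subgroup H -> S `<=` H -> S' `<=` H ->
  set_add S S' `<=` H.
Proof.
move=> aH SH S'H _ [x Sx [y S'y <-]].
by apply: additive_subgroupD => //; [apply: SH | apply: S'H].
Qed.

End AdditiveSpan.

(** * The involution and its extension to matrix units *)

Section FormRingTheory.
Variable A : formRing.
Implicit Types (x y a : A).

Lemma barD x y : bar (x + y) = bar x + bar y.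
Proof. by have [h _ _] := barP A; apply: h. Qed.

Lemma barM x y : bar (x * y) = bar y * bar x.
Proof. by have [_ h _] := barP A; apply: h. Qed.

Lemma barK x : bar (bar x) = x.
Proof. by have [_ _ h] := barP A; apply: h. Qed.

Lemma barB x y : bar (x - y) = bar x - bar y.
Proof. by rewrite barD barN. Qed.

Lemma bar1 : bar (1 : A) = 1.
Proof. by rewrite -[LHS]mulr1 -[X in _ * X]barK -barM mulr1 barK. Qed.

Lemma bar0 : bar (0 : A) = 0.
Proof. by have := barB 0 0; rewrite !subrr. Qed.

Lemma lambar_central x : bar (lam A) * x = x * bar (lam A).
Proof. by apply: (can_inj barK); rewrite !barM !barK lam_central. Qed.

Lemma lambar_lam : bar (lam A) * lam A = 1.
Proof. by rewrite -lam_central lam_unitary. Qed.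

End FormRingTheory.

Section Star.
Variables (A : formRing) (n : nat).
Implicit Types (x y : A) (i j k : 'I_(2 * n)).

(** The power [lam^(-(eps i + 1)/2)] that relates the long root parameters at
    [(i, -i)] to the form parameter. *)
Definition lam_half i : A := if (i < n)%N then bar (lam A) else 1.

Lemma ltn_rev_ord i : (rev_ord i < n)%N = ~~ (i < n)%N.
Proof. by have := ltn_ord i; rewrite /=; lia. Qed.

Lemma lam_half_central i x : lam_half i * x = x * lam_half i.
Proof.
by rewrite /lam_half; case: ifP; rewrite ?lambar_central // mulr1 mul1r.
Qed.

Lemma bar_lam_half_central i x : bar (lam_half i) * x = x * bar (lam_half i).
Proof. by apply: (can_inj (@barK A)); rewrite !barM barK lam_half_central. Qed.

Lemma lam_halfK i : lam_half i * bar (lam_half i) = 1.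
Proof.
by rewrite /lam_half; case: ifP; rewrite ?barK ?lambar_lam // bar1 mulr1.
Qed.

Lemma bar_lam_halfK i : bar (lam_half i) * lam_half i = 1.
Proof. by rewrite -lam_half_central lam_halfK. Qed.

Lemma lam_half_rev i : lam_half (rev_ord i) = bar (lam A) * bar (lam_half i).
Proof.
rewrite /lam_half ltn_rev_ord; case: (i < n)%N.
  by rewrite barK lambar_lam.
by rewrite bar1 mulr1.
Qed.

(** The adjunction with respect to the unitary form is the involution of the
    matrix ring that sends [x e_ij] to [star i j x e_(-j, -i)]. A short
    transvection is [1 + N - N^*] with [N = x e_ij], and the parameters at
    [(i, -i)] are skew for it. Writing every power of [lam] as a value of
    [star] removes the case distinctions on signs of indices from all
    relations. *)
Definition star i j x : A := lam_pow A ((eps j - eps i) %/ 2)%Z * bar x.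

Lemma starE i j x : star i j x = lam_half i * bar (lam_half j) * bar x.
Proof.
rewrite /star /lam_half /eps; congr (_ * _).
by case: ifP; case: ifP => _ _ /=;
  rewrite ?expr0 ?expr1 ?bar1 ?barK ?lambar_lam ?mulr1 ?mul1r.
Qed.

Lemma starD i j x y : star i j (x + y) = star i j x + star i j y.
Proof. by rewrite /star barD mulrDr. Qed.

Lemma starN i j x : star i j (- x) = - star i j x.
Proof. by rewrite /star barN mulrN. Qed.

Lemma starB i j x y : star i j (x - y) = star i j x - star i j y.
Proof. by rewrite starD starN. Qed.

Lemma starM i j k x y : star i k (x * y) = star j k y * star i j x.
Proof.
rewrite !starE barM -!mulrA [bar (lam_half j) * _]bar_lam_half_central.
rewrite [RHS]lam_half_central -!mulrA bar_lam_halfK mulr1.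
by rewrite [lam_half i * bar x]lam_half_central lam_half_central -!mulrA.
Qed.

Lemma starK i j x : star (rev_ord j) (rev_ord i) (star i j x) = x.
Proof.
have hrev : lam_half (rev_ord j) * bar (lam_half (rev_ord i)) =
    lam_half i * bar (lam_half j).
  rewrite !lam_half_rev !barM !barK -lam_central mulrA -[X in X * _]mulrA.
  by rewrite -lam_central mulrA lambar_lam mul1r lam_half_central.
rewrite !starE hrev !barM !barK [x * _]mulrA -[x * lam_half j]lam_half_central.
rewrite -[lam_half j * x * _]mulrA -[x * _]bar_lam_half_central !mulrA.
by rewrite -[_ * _ * lam_half j]mulrA bar_lam_halfK mulr1 lam_halfK mul1r.
Qed.

Lemma star_id i x : star i i x = bar x.
Proof. by rewrite starE lam_halfK mul1r. Qed.

Lemma lam_half_conj i k x y :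
  lam_half i * (x * y * bar x) = x * (lam_half k * y) * star i k x.
Proof.
rewrite starE -[lam_half i * _ * _]mulrA [RHS]mulrA.
rewrite -[_ * lam_half i]lam_half_central.
rewrite -[RHS]mulrA; congr (lam_half i * _).
rewrite [lam_half k * y]lam_half_central !mulrA.
by rewrite -[x * y * _ * _]mulrA lam_halfK mulr1.
Qed.

Lemma star_lam_half i x :
  star i (rev_ord i) (lam_half i * x) = lam_half i * (lam A * bar x).
Proof.
rewrite starE lam_half_rev !barM !barK -[bar x * _]bar_lam_half_central !mulrA.
rewrite -[_ * lam A * bar (lam_half i)]mulrA lam_central -!mulrA; congr (_ * _).
by rewrite !mulrA lam_halfK mul1r.
Qed.

End Star.

Arguments lam_half {A n} i.
Arguments star {A n} i j x.
(** * Levels of elementary subgroups *)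

Section Levels.
Variables (A : formRing) (n : nat).
Implicit Types (x y a : A) (i j k : 'I_(2 * n)) (P Q R : set A * set A).

(** What the commutator formulas use about a pair (ideal, parameter). Both
    form ideals and their symmetrised products have these properties. *)
Record level R : Prop := Level {
  level_sub1 : additive_subgroup R.1;
  level_ideal : forall a x, R.1 x -> R.1 (a * x) /\ R.1 (x * a);
  level_bar : forall x, R.1 x -> R.1 (bar x);
  level_sub2 : additive_subgroup R.2;
  level_incl : R.2 `<=` R.1;
  level_Lam : R.2 `<=` Lam A;
  level_trace : forall x, R.1 x -> R.2 (x - lam A * bar x)
}.

(** What is needed of [R] for the commutators of root elements of levels [P]
    and [Q] to have level [R]. Besides [R = P o Q], this covers [R = Q] when
    [P] is the whole form ring. *)
Record absorbs P Q R : Prop := Absorbs {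
  absorbs_mul : forall x y, P.1 x -> Q.1 y -> R.1 (x * y) /\ R.1 (y * x);
  absorbs_conj : forall x y, P.1 x -> Q.2 y -> R.2 (x * y * bar x);
  absorbs_conjC : forall x y, Q.1 x -> P.2 y -> R.2 (x * y * bar x)
}.

Lemma absorbsC P Q R : absorbs P Q R -> absorbs Q P R.
Proof.
case=> m c1 c2; split=> // x y Qx Py; have [] := m _ _ Py Qx; by split.
Qed.

Lemma params_short P i j : j != rev_ord i -> params P i j = P.1.
Proof. by rewrite /params => /negbTE ->. Qed.

Lemma lam_half_params i : lam_pow A (- ((eps i + 1) %/ 2)%Z) = lam_half i.
Proof. by rewrite /lam_half /eps; case: ifP => _ /=; rewrite ?expr1 ?expr0. Qed.

Lemma params_long P i x :
  params P i (rev_ord i) x <-> P.2 (bar (lam_half i) * x).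
Proof.
rewrite /params eqxx lam_half_params; split=> [[y Py <-] | Px].
  by rewrite mulrA bar_lam_halfK mul1r.
by exists (bar (lam_half i) * x) => //; rewrite mulrA lam_halfK mul1r.
Qed.

Lemma params_mono P Q i j : P.1 `<=` Q.1 -> P.2 `<=` Q.2 ->
  params P i j `<=` params Q i j.
Proof.
move=> s1 s2 x; rewrite /params; case: ifP => _; last exact: s1.
by case=> y /s2 Qy <-; exists y.
Qed.

Lemma params_subgroup P i j : level P -> additive_subgroup (params P i j).
Proof.
move=> lP; rewrite /params; case: ifP => _; last exact: level_sub1.
have [P0 PB] := level_sub2 lP; split; first by exists 0 => //; rewrite mulr0.
move=> _ _ [x Px <-] [y Py <-]; exists (x - y); first exact: PB.
by rewrite mulrBr.
Qed.

Lemma paramsN P i j x : level P -> params P i j x -> params P i j (- x).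
Proof.
by move=> lP Px; apply: additive_subgroupN Px; apply: params_subgroup.
Qed.

Lemma paramsD P i j x y : level P ->
  params P i j x -> params P i j y -> params P i j (x + y).
Proof.
by move=> lP Px; apply: additive_subgroupD Px; apply: params_subgroup.
Qed.

Lemma params_incl P i j : level P -> params P i j `<=` P.1.
Proof.
move=> lP x; rewrite /params; case: ifP => // _ [y /(level_incl lP) Py <-].
exact: (level_ideal lP _ Py).1.
Qed.

Lemma level_star P i j x : level P -> P.1 x -> P.1 (star i j x).
Proof.
by move=> lP Px; apply: (level_ideal lP _ _).1; apply: level_bar.
Qed.

Lemma long_star P i x : level P -> params P i (rev_ord i) x ->
  star i (rev_ord i) x = - x.
Proof.
move=> lP /params_long /(level_Lam lP) Lx.
have [_ _ /(_ _ Lx) + _] := LamP A; rewrite /Lambda_max /= barM barK => e.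
rewrite starE lam_half_rev barM !barK -[_ * lam A]lam_central.
rewrite -[x in RHS]mul1r -(lam_halfK A i) -[in RHS]mulrA e mulrN opprK.
by rewrite -[bar x * _]lam_half_central !mulrA.
Qed.

Lemma long_trace P i x : level P -> P.1 x ->
  params P i (rev_ord i) (x - star i (rev_ord i) x).
Proof.
move=> lP Px; apply/params_long.
have := level_trace lP (level_ideal lP (bar (lam_half i)) Px).1.
suff -> : lam A * bar (bar (lam_half i) * x) =
    bar (lam_half i) * star i (rev_ord i) x.
  by rewrite -mulrBr.
rewrite starE lam_half_rev barM !barM !barK -lam_half_central.
by rewrite !mulrA bar_lam_halfK mul1r -lam_central.
Qed.

Lemma long_conj P Q R i j x y : absorbs P Q R ->
  P.1 x -> params Q j (rev_ord j) y ->
  params R i (rev_ord i) (x * y * star i j x).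
Proof.
move=> aPQ Px /params_long Qy; apply/params_long.
have := absorbs_conj aPQ Px Qy; congr (R.2 _).
rewrite starE -[lam_half i * _ * _]mulrA lam_half_central [x * y * _]mulrA.
rewrite -[x * y * _ * lam_half i]lam_half_central [RHS]mulrA bar_lam_halfK.
rewrite mul1r !mulrA.
congr (_ * _); by rewrite -[RHS]mulrA -[y * _]bar_lam_half_central mulrA.
Qed.

Lemma form_ideal_level P : form_ideal P -> level P.
Proof.
case=> [[sP idP] barP' [sP2 minP maxP _]]; split=> //.
- by move=> x Px; rewrite -barP'; exists x.
- by move=> x /maxP[].
- by move=> x /maxP[].
- move=> x Px; apply: minP; exists (x - lam A * bar x); first by exists x.
  by exists 0; [exact: (additive_span_subgroup _).1 | rewrite addr0].
Qed.

Lemma conj_span_subgroup (I G : set A) : additive_subgroup (conj_span I G).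
Proof. exact: additive_span_subgroup. Qed.

Lemma trace_subgroup (I : set A) : additive_subgroup I ->
  additive_subgroup [set x - lam A * bar x | x in I].
Proof.
move=> [I0 IB]; split.
  by exists 0 => //; rewrite bar0 mulr0 subrr.
move=> _ _ [x Ix <-] [y Iy <-]; exists (x - y); first exact: IB.
by rewrite barB mulrBr !opprB addrACA [RHS]addrACA [- y - _]addrC.
Qed.

Lemma full_form_ideal : form_ideal (setT, Lam A).
Proof.
have [sL minL maxL cL] := LamP A.
split; first by [].
  by apply/seteqP; split=> // x _; exists (bar x); rewrite ?barK.
split=> //=.
rewrite /Gamma_min /=; apply: set_add_min => //.
by apply: additive_span_min => // _ [x _ [y Ly <-]]; apply: cL.
Qed.

(** [(A, Lam) o P] is contained in [P], so one commutator formula also governs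
    the action of the absolute group on the relative ones. *)
Lemma absorbs_full P : form_ideal P -> absorbs (setT, Lam A) P P.
Proof.
move=> fP; have lP := form_ideal_level fP.
have [_ _ [sP2 minP _ cP]] := fP; split=> /= x y.
- by move=> _ Py; apply: level_ideal.
- by move=> _ Py; apply: cP.
- move=> Px Ly; apply: minP; apply: set_addr.
    exact/trace_subgroup/(level_sub1 lP).
  by apply: mem_additive_span; exists x => //; exists y.
Qed.

Lemma mulideal_bar (I J : set A) : (forall x, I x -> I (bar x)) ->
  (forall x, J x -> J (bar x)) ->
  forall x, ideal_mul I J x -> ideal_mul J I (bar x).
Proof.
move=> bI bJ; apply: (@additive_span_min _ _ [set x | ideal_mul J I (bar x)]).
  have [J0 JB] := additive_span_subgroup [set x * y | x in J & y in I].
  split=> [|x y Jx Jy] /=; first by rewrite bar0.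
  by rewrite barB; apply: JB.
move=> _ [x Ix [y Jy <-]] /=; apply: mem_additive_span.
by exists (bar y); [apply: bJ | exists (bar x); [apply: bI | rewrite barM]].
Qed.

Lemma mulideal_ideal (I J : set A) : two_sided_ideal I -> two_sided_ideal J ->
  two_sided_ideal (ideal_mul I J).
Proof.
move=> [sI cI] [sJ cJ].
have sIJ := additive_span_subgroup [set x * y | x in I & y in J].
have [IJ0 IJB] := sIJ.
split=> // a x IJx; split.
- move: x IJx; apply: (@additive_span_min _ _ [set x | ideal_mul I J (a * x)]).
    by split=> [|x y Ix Iy] /=; rewrite ?mulr0 ?mulrBr //; apply: IJB.
  move=> _ [x Ix [y Jy <-]] /=; apply: mem_additive_span.
  by exists (a * x); [exact: (cI a x Ix).1 | exists y; rewrite ?mulrA].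
- move: x IJx; apply: (@additive_span_min _ _ [set x | ideal_mul I J (x * a)]).
    by split=> [|x y Ix Iy] /=; rewrite ?mul0r ?mulrBl //; apply: IJB.
  move=> _ [x Ix [y Jy <-]] /=; apply: mem_additive_span.
  by exists x => //; exists (y * a); [exact: (cJ a y Jy).2 | rewrite mulrA].
Qed.

Section Product.
Variables P Q : set A * set A.
Hypotheses (fP : form_ideal P) (fQ : form_ideal Q).
Let K : set A := (form_ideal_mul P Q).1.

Lemma product_absorbs : absorbs P Q (form_ideal_mul P Q).
Proof.
have lP := form_ideal_level fP; have lQ := form_ideal_level fQ.
have sPQ := additive_span_subgroup [set x * y | x in P.1 & y in Q.1].
have sQP := additive_span_subgroup [set x * y | x in Q.1 & y in P.1].
split=> x y /=.
- move=> Px Qy; split.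
    apply: set_addl => //; apply: mem_additive_span.
    by exists x => //; exists y.
  by apply: set_addr => //; apply: mem_additive_span; exists y => //; exists x.
- move=> Px Qy; apply: set_addr; last first.
    by apply: mem_additive_span; exists x => //; exists y.
  apply: set_add_subgroup; last exact: conj_span_subgroup.
  apply: set_add_subgroup; last exact: conj_span_subgroup.
  exact/trace_subgroup/set_add_subgroup.
- move=> Qx Py; apply: set_addl; first exact: conj_span_subgroup.
  apply: set_addr; last by apply: mem_additive_span; exists x => //; exists y.
  apply: set_add_subgroup; last exact: conj_span_subgroup.
  exact/trace_subgroup/set_add_subgroup.
Qed.

Lemma product_level : level (form_ideal_mul P Q).
Proof.
have lP := form_ideal_level fP; have lQ := form_ideal_level fQ.
have [[i1 _ [sP2 minP maxP cP]] [i2 _ [sQ2 minQ maxQ cQ]]] := (fP, fQ).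
have [sL minL _ cL] := LamP A.
have sPQ := additive_span_subgroup [set x * y | x in P.1 & y in Q.1].
have sQP := additive_span_subgroup [set x * y | x in Q.1 & y in P.1].
have sK : additive_subgroup K by apply: set_add_subgroup.
have sG : additive_subgroup (Gamma_min K).
  apply: set_add_subgroup; last exact: conj_span_subgroup.
  exact: trace_subgroup.
have mulK a x : K x -> K (a * x) /\ K (x * a).
  have [_ /(_ a) c1] := mulideal_ideal i1 i2.
  have [_ /(_ a) c2] := mulideal_ideal i2 i1.
  move=> [y /c1[y1 y2] [z /c2[z1 z2] <-]].
  by split; [exists (a * y) => //; exists (a * z); rewrite ?mulrDr
            | exists (y * a) => //; exists (z * a); rewrite ?mulrDl].
have barK' x : K x -> K (bar x).
  move=> [y + [z + <-]] => /(mulideal_bar (level_bar lP) (level_bar lQ)) y1.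
  move=> /(mulideal_bar (level_bar lQ) (level_bar lP)) z1.
  by exists (bar z) => //; exists (bar y) => //; rewrite barD addrC.
have aK := product_absorbs.
split=> //=.
- by do 2![apply: set_add_subgroup; last exact: conj_span_subgroup].
- apply: set_add_min => //; first apply: set_add_min => //;
    first apply: set_add_min => //.
  + move=> _ [x Kx <-]; apply: sK.2 => //; exact: (mulK _ _ (barK' _ Kx)).1.
  + apply: additive_span_min => // _ [x Kx [y _ <-]].
    by rewrite -mulrA; apply: (mulK _ _ Kx).2.
  + apply: additive_span_min => // _ [x Qx [y Py <-]].
    apply: (mulK _ _ _).2; exact: (absorbs_mul aK (level_incl lP Py) Qx).2.
  + apply: additive_span_min => // _ [x Px [y Qy <-]].
    apply: (mulK _ _ _).2; exact: (absorbs_mul aK Px (level_incl lQ Qy)).1.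
- apply: set_add_min => //; first apply: set_add_min => //;
    first apply: set_add_min => //.
  + by move=> _ [x Kx <-]; apply: minL; exists x.
  + by apply: additive_span_min => // _ [x _ [y Ly <-]]; apply: cL.
  + apply: additive_span_min => // _ [x _ [y Py <-]]; apply: cL.
    exact: level_Lam Py.
  + apply: additive_span_min => // _ [x _ [y Qy <-]]; apply: cL.
    exact: level_Lam Qy.
- move=> x Kx; apply: set_addl; first exact: conj_span_subgroup.
  apply: set_addl; first exact: conj_span_subgroup.
  by apply: set_addl; [exact: conj_span_subgroup | exists x].
Qed.

End Product.

End Levels.

(** * The Steinberg relations *)

(** All commutator relations have this shape, [1 + c] and [1 + d] being the
    root elements at the sum and at the remaining combination of the two
    roots. It is stated without inverses so that only products of nilpotent
    parts occur. *)
Lemma unipotent_commutator (R : pzRingType) (a b c d : R) :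
  c = a * b - b * a -> d = - (c * a) -> c * b = 0 ->
  d * a = 0 -> d * b = 0 -> c * d = 0 ->
  (1 + a) * (1 + b) = (1 + c) * (1 + d) * (1 + b) * (1 + a).
Proof.
move=> ec ed cb da db cd.
rewrite [(1 + c) * _]mulrDl mul1r [c * (1 + d)]mulrDr mulr1 cd addr0.
have -> : (1 + d + c) * (1 + b) = 1 + b + d + c.
  by rewrite !mulrDl mul1r !mulrDr !mulr1 db cb !addr0.
rewrite !mulrDl mul1r !mulrDr !mulr1 da addr0 ed ec.
rewrite mul1r; set X := (_ - _) * a.
rewrite -[_ - X + _]addrA [- X + _]addrC addrK -[RHS]addrA.
by rewrite [b + _ + _]addrACA subrr addr0 addrACA.
Qed.

Section Indices.
Variable n : nat.
Implicit Types i j : 'I_(2 * n).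

Lemma rev_eq i j : (rev_ord i == rev_ord j) = (i == j).
Proof. exact: (inj_eq rev_ord_inj). Qed.

Lemma rev_eqC i j : (rev_ord i == j) = (i == rev_ord j).
Proof. by rewrite -rev_eq rev_ordK. Qed.

Lemma rev_eqF i : (i == rev_ord i) = false.
Proof. by rewrite eq_sym; apply/negbTE/rev_ord_neq. Qed.

Definition apart i j := (i != j) && (i != rev_ord j).

Lemma apartC i j : apart i j = apart j i.
Proof.
by rewrite /apart [i == j]eq_sym -[i == _]rev_eqC [rev_ord i == j]eq_sym.
Qed.

Lemma apart_revl i j : apart (rev_ord i) j = apart i j.
Proof. by rewrite /apart rev_eqC rev_eq andbC. Qed.

Lemma apart_revr i j : apart i (rev_ord j) = apart i j.
Proof. by rewrite apartC apart_revl apartC. Qed.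

Lemma apartE i j : apart i j ->
  ((i == j) = false) * ((j == i) = false) *
  ((i == rev_ord j) = false) * ((j == rev_ord i) = false).
Proof.
move=> aij; have := aij; rewrite apartC => /andP[/negbTE-> /negbTE->].
by have /andP[/negbTE-> /negbTE->] := aij.
Qed.

End Indices.

(** The theorem holds in any group with root elements subject to the Steinberg
    relations, for instance in the unitary Steinberg group, because nothing
    else about the transvections enters its proof. *)
Record steinberg (A : formRing) (n : nat) (G : groupType)
    (T : 'I_(2 * n) -> 'I_(2 * n) -> A -> G) : Prop := Steinberg {
  steinberg_add : forall i j x y, i != j ->
    T i j (x + y) = (T i j x * T i j y)%g;
  steinberg_rev : forall i j x, i != j -> j != rev_ord i ->
    T i j x = T (rev_ord j) (rev_ord i) (- star i j x);
  steinberg_far : forall i j k l x y, i != j -> k != l ->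
    k != j -> k != rev_ord i -> l != i -> l != rev_ord j ->
    lcomm (T i j x) (T k l y) = 1%g;
  steinberg_chain : forall i j l x y, apart i j -> apart j l -> apart i l ->
    lcomm (T i j x) (T j l y) = T i l (x * y);
  steinberg_short : forall i j x y, apart i j ->
    lcomm (T i j x) (T j (rev_ord i) y) =
    T i (rev_ord i) (x * y - star i (rev_ord i) (x * y));
  steinberg_long : forall i j x a, apart i j -> star j (rev_ord j) a = - a ->
    lcomm (T i j x) (T j (rev_ord j) a) =
    (T i (rev_ord j) (x * a)%R * T i (rev_ord i) (x * a * star i j x)%R)%g
}.

Section Transvections.
Variables (A : formRing) (n : nat).
Implicit Types (x y a : A) (i j k l : 'I_(2 * n)).
Local Notation T := (@transv A n).

Lemma mul_elem i j k l x y :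
  (x *: delta_mx i j : 'M[A]_(2 * n)) *m (y *: delta_mx k l) =
  if j == k then (x * y) *: delta_mx i l else 0.
Proof.
apply/matrixP => u v; rewrite !mxE (bigD1 j) //= big1 => [|w wj].
  rewrite !mxE eqxx andbT addr0; case: (eqVneq j k) => [_|_]; rewrite !mxE.
    by case: (u == i); case: (v == l); rewrite /= ?mulr0 ?mulr1 ?mul0r ?mulr0.
  by rewrite /= !mulr0.
by rewrite !mxE (negbTE wj) andbF !mulr0 mul0r.
Qed.

Definition nilpart i j x : 'M[A]_(2 * n) :=
  if j == rev_ord i then x *: delta_mx i j
  else x *: delta_mx i j - star i j x *: delta_mx (rev_ord j) (rev_ord i).

Lemma gl_mx_nilpart i j x : i != j -> gl_mx (T i j x) = 1%:M + nilpart i j x.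
Proof.
move=> ij; rewrite gl_mx_transv // /transv_mx /nilpart.
by case: ifP => // _; rewrite -addrA.
Qed.

Lemma nilpart_long i x :
  nilpart i (rev_ord i) x = x *: delta_mx i (rev_ord i).
Proof. by rewrite /nilpart eqxx. Qed.

Lemma nilpart_short i j x : j != rev_ord i -> nilpart i j x =
  x *: delta_mx i j - star i j x *: delta_mx (rev_ord j) (rev_ord i).
Proof. by rewrite /nilpart => /negbTE ->. Qed.

Lemma nilpartD i j x y : nilpart i j (x + y) = nilpart i j x + nilpart i j y.
Proof.
rewrite /nilpart; case: ifP => _; rewrite ?starD !scalerDl //.
by rewrite opprD addrACA.
Qed.

Lemma nilpart_mul0 i j k l x y : j != k -> l != rev_ord j ->
  k != rev_ord i -> l != i -> nilpart i j x *m nilpart k l y = 0.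
Proof.
move=> jk lj ki li; rewrite /nilpart.
have jl : (j == rev_ord l) = false by rewrite eq_sym rev_eqC (negbTE lj).
have ik : (rev_ord i == k) = false by rewrite eq_sym (negbTE ki).
have il : (i == l) = false by rewrite eq_sym (negbTE li).
by case: ifP => _; case: ifP => _;
  rewrite ?mulmxBl ?mulmxBr ?mul_elem ?rev_eq ?jl ?ik ?il ?(negbTE jk) ?subr0.
Qed.

Lemma transv_add i j x y : i != j -> T i j (x + y) = (T i j x * T i j y)%g.
Proof.
move=> ij; apply: gl_mx_inj; rewrite [RHS]/gl_mx /= -!/(gl_mx _).
rewrite !gl_mx_nilpart // nilpartD mulmxDl mul1mx mulmxDr mulmx1.
rewrite nilpart_mul0 ?addr0; first by rewrite addrA addrAC.
- by rewrite eq_sym.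
- by rewrite rev_eqF.
- by rewrite rev_eqF.
- by rewrite eq_sym.
Qed.

Lemma transv_rev i j x : i != j -> j != rev_ord i ->
  T i j x = T (rev_ord j) (rev_ord i) (- star i j x).
Proof.
move=> ij jni; apply: gl_mx_inj.
have ji : rev_ord j != rev_ord i by rewrite rev_eq eq_sym.
rewrite !gl_mx_nilpart // !nilpart_short //; last by rewrite rev_ordK eq_sym.
by rewrite !rev_ordK starN starK !scaleNr opprK [- _ + _]addrC.
Qed.

Lemma lcomm_transv i j k l x y (z : GL A (2 * n)) c d : i != j -> k != l ->
  gl_mx z = (1%:M + c) *m (1%:M + d) ->
  c = nilpart i j x *m nilpart k l y - nilpart k l y *m nilpart i j x ->
  d = - (c *m nilpart i j x) -> c *m nilpart k l y = 0 ->
  d *m nilpart i j x = 0 -> d *m nilpart k l y = 0 -> c *m d = 0 ->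
  lcomm (T i j x) (T k l y) = z.
Proof.
move=> ij kl ez ec ed cb da db cd.
have e : (T i j x * T k l y = z * T k l y * T i j x)%g.
  apply: gl_mx_inj; rewrite /gl_mx /= -!/(gl_mx _) ez !gl_mx_nilpart //.
  exact: (@unipotent_commutator 'M[A]_(2 * n)).
by rewrite /lcomm e !mulgK.
Qed.

Lemma lcomm_far i j k l x y : i != j -> k != l ->
  k != j -> k != rev_ord i -> l != i -> l != rev_ord j ->
  lcomm (T i j x) (T k l y) = 1%g.
Proof.
move=> ij kl kj ki li lj.
have e1 : nilpart i j x *m nilpart k l y = 0.
  by apply: nilpart_mul0; rewrite // eq_sym.
have e2 : nilpart k l y *m nilpart i j x = 0.
  by apply: nilpart_mul0; rewrite // -?[_ == rev_ord _]rev_eqC eq_sym.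
apply: (@lcomm_transv _ _ _ _ _ _ _ 0 0);
  rewrite ?mul0mx ?mulmx0 ?oppr0 ?e1 ?e2 ?subrr //.
by rewrite addr0 mulmx1.
Qed.

(** Evaluates a product of elementary matrices, [h] telling indices apart. *)
Local Ltac elem h :=
  rewrite ?(mulmxBl, mulmxBr, mul_elem, rev_ordK, rev_eq, rev_eqC, rev_eqF,
      eqxx, h)
    ?(subr0, sub0r, oppr0, opprK).

Lemma lcomm_chain i j l x y : apart i j -> apart j l -> apart i l ->
  lcomm (T i j x) (T j l y) = T i l (x * y).
Proof.
move=> /apartE ij /apartE jl /apartE il; pose h := (ij, jl, il).
apply: (@lcomm_transv _ _ _ _ _ _ _ (nilpart i l (x * y)) 0);
  rewrite ?ij ?jl ?mulmx0 ?mul0mx //.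
- by rewrite gl_mx_nilpart ?il // addr0 mulmx1.
- by rewrite !nilpart_short ?h //; elem h; rewrite (starM i j l).
- by rewrite !nilpart_short ?h //; elem h.
- by rewrite !nilpart_short ?h //; elem h.
Qed.

Lemma lcomm_short_long i j x y : apart i j ->
  lcomm (T i j x) (T j (rev_ord i) y) =
  T i (rev_ord i) (x * y - star i (rev_ord i) (x * y)).
Proof.
move=> /apartE ij; set z := _ - _.
apply: (@lcomm_transv _ _ _ _ _ _ _ (nilpart i (rev_ord i) z) 0);
  rewrite ?(ij, rev_eqF) ?mulmx0 ?mul0mx //.
- by rewrite gl_mx_nilpart ?rev_eqF // addr0 mulmx1.
- rewrite nilpart_long !nilpart_short ?rev_eq ?ij //; elem ij.
  by rewrite /z (starM i j) scalerBl.
- by rewrite nilpart_long !nilpart_short ?rev_eq ?ij //; elem ij.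
- by rewrite nilpart_long !nilpart_short ?rev_eq ?ij //; elem ij.
Qed.

Lemma lcomm_long i j x a : apart i j -> star j (rev_ord j) a = - a ->
  lcomm (T i j x) (T j (rev_ord j) a) =
  (T i (rev_ord j) (x * a) * T i (rev_ord i) (x * a * star i j x))%g.
Proof.
move=> /apartE ij sa.
apply: (@lcomm_transv _ _ _ _ _ _ _ (nilpart i (rev_ord j) (x * a))
   (nilpart i (rev_ord i) (x * a * star i j x)));
  rewrite ?nilpart_long ?nilpart_short ?rev_eq ?(ij,rev_eqF) //; elem ij => //.
- rewrite [LHS]/gl_mx /= -!/(gl_mx _) !gl_mx_nilpart ?ij ?rev_eqF //.
  by rewrite nilpart_long nilpart_short ?rev_eq ?ij // rev_ordK.
- by rewrite (starM i j) sa mulNr scaleNr opprK.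
Qed.

Lemma transv_steinberg : steinberg T.
Proof.
split; [exact: transv_add | exact: transv_rev | exact: lcomm_far
  | exact: lcomm_chain | exact: lcomm_short_long | exact: lcomm_long].
Qed.

End Transvections.

(** * Roots and weights *)

Section Weights.
Variable n : nat.
Implicit Types (i j k l m p : 'I_(2 * n)) (f : 'I_(2 * n) -> int).

(** An odd function on the indices is a linear form on the root lattice, with
    value [f i - f j] at the root [(i, j)]. *)
Definition odd_weight f := forall i, f (rev_ord i) = - f i.

(** By the relation [T_ij(x) = T_(-j, -i)(- star x)], the pairs [(i, j)] and
    [(-j, -i)] name the same root. *)
Definition same_root i j k l :=
  (i == k) && (j == l) || (i == rev_ord l) && (j == rev_ord k).

Definition dirac_weight p m : int := (m == p)%:Z - (m == rev_ord p)%:Z.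

Lemma dirac_weight_odd p : odd_weight (dirac_weight p).
Proof. by move=> m; rewrite /dirac_weight rev_eqC rev_eq opprB. Qed.

Lemma dirac_weight_id p : dirac_weight p p = 1.
Proof. by rewrite /dirac_weight eqxx rev_eqF. Qed.

Lemma dirac_weight_apart p m : apart p m -> dirac_weight p m = 0.
Proof. by move=> /apartE pm; rewrite /dirac_weight !pm. Qed.

Lemma dirac_weight_neq p m : p != m -> dirac_weight p m != 1.
Proof.
by rewrite /dirac_weight [m == p]eq_sym => /negbTE ->; case: (m == _).
Qed.

(** Roots that are not proportional are linearly independent, so a linear form
    can vanish on one of them and be positive on the other; the coordinate of
    an index of one root, or a sum of two coordinates, is enough. This puts
    the former root in a Levi subgroup and the latter in the unipotent
    radical. *)
Lemma separating_weight i j k l : i != j -> k != l ->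
  ~~ same_root i j k l -> ~~ same_root i j l k ->
  exists f, [/\ odd_weight f, f k = f l & f j < f i].
Proof.
move=> ij kl s1 s2.
suff [f [of_ fkl fij]] : exists f, [/\ odd_weight f, f k = f l & f i != f j].
  have [lt|lt] := ltP (f j) (f i); first by exists f.
  exists (fun m => - f m); split; first by move=> m; rewrite of_.
    by rewrite fkl.
  by rewrite ltrN2 lt_neqAle fij.
have [/andP[ik il]|ai] := boolP (apart i k && apart i l).
  exists (dirac_weight i); split; first exact: dirac_weight_odd.
    by rewrite !dirac_weight_apart.
  by rewrite dirac_weight_id eq_sym dirac_weight_neq.
have [/andP[jk jl]|aj] := boolP (apart j k && apart j l).
  exists (dirac_weight j); split; first exact: dirac_weight_odd.
    by rewrite !dirac_weight_apart.
  by rewrite dirac_weight_id dirac_weight_neq // eq_sym.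
have [ekl|nkl] := eqVneq l (rev_ord k).
  move: s1 s2 ai aj ij; rewrite ekl /same_root rev_ordK !apart_revr !andbb.
  rewrite /apart !negb_and !negbK.
  move=> s1 s2 /orP[]/eqP ei /orP[]/eqP ej; rewrite ei ej ?eqxx // => ij.
    by move: s1; rewrite ei ej !eqxx.
  by move: s2; rewrite ei ej !eqxx orbT.
have akl : apart k l by rewrite /apart kl -rev_eqC eq_sym.
exists (fun m => dirac_weight k m + dirac_weight l m); split.
- by move=> m; rewrite [RHS]opprD; congr (_ + _); apply: dirac_weight_odd.
- by rewrite !dirac_weight_id !dirac_weight_apart // apartC.
have ckl : dirac_weight k l = 0 by rewrite dirac_weight_apart.
have clk : dirac_weight l k = 0 by rewrite dirac_weight_apart // apartC.
move: ai aj s1 s2 ij; rewrite /same_root /apart !negb_and !negbK -!orbA.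
by do 2![case/or4P => /eqP->]; rewrite ?dirac_weight_odd ?dirac_weight_id
  ?ckl ?clk ?rev_ordK ?eqxx ?orbT.
Qed.

End Weights.

Lemma exists_apart n (i j : 'I_(2 * n)) : (3 <= n)%N ->
  exists2 k, apart k i & apart k j.
Proof.
move=> hn; pose s := [:: i; rev_ord i; j; rev_ord j].
have [k ks] : exists k, k \notin s.
  apply/existsP; rewrite -negb_forall; apply/negP => /forallP all_s.
  have : (#|'I_(2 * n)| <= size s)%N.
    rewrite cardE; apply: uniq_leq_size; first exact: enum_uniq.
    by move=> k _; apply: all_s.
  by rewrite card_ord /=; lia.
by move: ks; rewrite !inE !negb_or => /and4P[ki kri kj krj];
  exists k; apply/andP; split.
Qed.



(** * Unipotent radicals *)

Section Chevalley.
Variables (A : formRing) (n : nat).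
Implicit Types (x y a : A) (i j k l : 'I_(2 * n)) (P Q R : set A * set A).
Implicit Types (f : 'I_(2 * n) -> int).
Local Notation AL := ([set: A], Lam A).
Variables (G : groupType) (T : 'I_(2 * n) -> 'I_(2 * n) -> A -> G).
Hypothesis hT : steinberg T.
Local Arguments T (_ _) _%_ring_scope.

Let rootD i j x y : i != j -> T i j (x + y) = (T i j x * T i j y)%g.
Proof. exact: steinberg_add. Qed.

Let root_rev i j x : i != j -> j != rev_ord i ->
  T i j x = T (rev_ord j) (rev_ord i) (- star i j x).
Proof. exact: steinberg_rev. Qed.

Let root_far i j k l x y : i != j -> k != l ->
  k != j -> k != rev_ord i -> l != i -> l != rev_ord j ->
  lcomm (T i j x) (T k l y) = 1%g.
Proof. exact: steinberg_far. Qed.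

Let root_chain i j l x y : apart i j -> apart j l -> apart i l ->
  lcomm (T i j x) (T j l y) = T i l (x * y).
Proof. exact: steinberg_chain. Qed.

Let root_short i j x y : apart i j ->
  lcomm (T i j x) (T j (rev_ord i) y) =
  T i (rev_ord i) (x * y - star i (rev_ord i) (x * y)).
Proof. exact: steinberg_short. Qed.

Let root_long i j x a : apart i j -> star j (rev_ord j) a = - a ->
  lcomm (T i j x) (T j (rev_ord j) a) =
  (T i (rev_ord j) (x * a) * T i (rev_ord i) (x * a * star i j x))%g.
Proof. exact: steinberg_long. Qed.

Let root0 i j : i != j -> T i j 0 = 1%g.
Proof.
by move=> ij; apply: (mulgI (T i j 0)); rewrite -rootD // addr0 mulg1.
Qed.

Let rootN i j x : i != j -> T i j (- x) = (T i j x)^-1%g.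
Proof.
move=> ij; apply: (mulgI (T i j x)).
by rewrite -rootD // subrr root0 // mulgV.
Qed.

Definition rootFU P : set G := generated
  [set g | exists i j xi, [/\ i != j, params P i j xi & g = T i j xi]].

(** The unipotent radical, of level [P], of the parabolic subgroup defined by
    the weight [f]. *)
Definition radical f P : set G := generated
  [set g | exists i j xi,
    [/\ i != j, f j < f i, params P i j xi & g = T i j xi]].

Lemma radical_subgroup f P : subgroup (radical f P).
Proof. exact: generated_subgroup. Qed.

Lemma mem_radical f P i j x : i != j -> f j < f i -> params P i j x ->
  radical f P (T i j x).
Proof. by move=> ij fij Px; apply: mem_generated; exists i, j, x. Qed.

Lemma mem_rootFU P i j x : i != j -> params P i j x -> rootFU P (T i j x).
Proof. by move=> ij Px; apply: mem_generated; exists i, j, x. Qed.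

Lemma radical_FU f P : radical f P `<=` rootFU P.
Proof.
by apply: generated_mono => _ [i [j [x [ij _ Px ->]]]]; exists i, j, x.
Qed.

Lemma params_rev P i j x : level P -> i != j -> params P i j x ->
  exists2 y, params P (rev_ord j) (rev_ord i) y &
             T i j x = T (rev_ord j) (rev_ord i) y.
Proof.
move=> lP ij Px; have [ej|nj] := eqVneq j (rev_ord i).
  by exists x; rewrite ej rev_ordK // -ej.
exists (- star i j x); last exact: root_rev.
move: Px; rewrite !params_short // ?rev_ordK 1?eq_sym // => Px.
by apply: additive_subgroupN; [apply: level_sub1 | apply: level_star].
Qed.

Definition rootEU P : set G := normal_closure (rootFU AL) (rootFU P).

Section Commutator.
Variables (f : 'I_(2 * n) -> int) (of_ : odd_weight f).

Let lcomm_radical_short P Q R i j l x y : level P -> level Q -> level R ->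
  absorbs P Q R -> apart i j -> j != l -> l != i ->
  f j <= f i -> f l <= f j -> f l < f i ->
  params P i j x -> params Q j l y -> radical f R (lcomm (T i j x) (T j l y)).
Proof.
move=> lP lQ lR aR aij jl li fij fjl fil Px Qy.
have /apartE ij := aij.
have P1 := params_incl lP Px; have Q1 := params_incl lQ Qy.
have [Rxy _] := absorbs_mul aR P1 Q1.
have [_ RM _] := radical_subgroup f R.
have [el|njl] := eqVneq l (rev_ord j).
  move: Qy fjl fil; rewrite el of_ => Qy fjl fil.
  rewrite root_long //; last exact: long_star Qy.
  apply: RM; apply: mem_radical; rewrite ?of_ ?ij ?rev_eqF //.
  - by rewrite params_short // rev_eq ij.
  - by lia.
  - exact: long_conj aR P1 Qy.
have [el|nil] := eqVneq l (rev_ord i).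
  move: fil; rewrite el of_ => fil; rewrite root_short //.
  by apply: mem_radical; rewrite ?of_ ?rev_eqF //; apply: long_trace.
rewrite root_chain //.
- by apply: mem_radical; rewrite // 1?eq_sym // params_short.
- by rewrite /apart jl -rev_eqC eq_sym.
- by rewrite /apart eq_sym li -rev_eqC eq_sym.
Qed.

Let lcomm_radical_chain P Q R i j l x y : level P -> level Q -> level R ->
  absorbs P Q R -> i != j -> j != l -> f j <= f i -> f l <= f j -> f l < f i ->
  params P i j x -> params Q j l y -> radical f R (lcomm (T i j x) (T j l y)).
Proof.
move=> lP lQ lR aR ij jl fij fjl fil Px Qy.
have li : l != i by apply: contraTneq fil => ->; rewrite ltxx.
have [ej|nij] := eqVneq j (rev_ord i); last first.
  apply: (lcomm_radical_short lP lQ lR aR) => //.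
  by rewrite /apart ij -rev_eqC eq_sym.
have [_ _ RV] := radical_subgroup f R.
have [y' Qy' ->] := params_rev lQ jl Qy.
rewrite -lcommV; apply: RV.
have ei : i = rev_ord j by rewrite ej rev_ordK.
move: li fij fil Px; rewrite ei of_ => li fij fil Px.
apply: (lcomm_radical_short lQ lP lR (absorbsC aR)); rewrite ?of_ ?lerN2 //.
- by rewrite apart_revl apart_revr /apart li eq_sym jl.
- exact: rev_ord_neq.
- by rewrite -rev_eqC eq_sym.
- by rewrite ltrNr.
Qed.

(** The Chevalley commutator formula: the factors of the commutator lie in the
    root subgroups of the sums [p r + q s] with [p, q >= 1], at which the
    weight is positive. *)
Lemma lcomm_radical P Q R i j k l x y : level P -> level Q -> level R ->
  absorbs P Q R -> i != j -> k != l ->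
  f j <= f i -> f l <= f k -> f j + f l < f i + f k ->
  params P i j x -> params Q k l y -> radical f R (lcomm (T i j x) (T k l y)).
Proof.
move=> lP lQ lR aR ij kl fij fkl fs Px Qy.
have rij : rev_ord j != rev_ord i by rewrite rev_eq eq_sym.
have rkl : rev_ord l != rev_ord k by rewrite rev_eq eq_sym.
have [ekj|kj] := eqVneq k j.
  subst k; apply: (lcomm_radical_chain lP lQ lR aR) => //.
  by move: fs; rewrite addrC ltrD2r.
have [eki|ki] := eqVneq k (rev_ord i).
  have [x' Px' ->] := params_rev lP ij Px; subst k.
  apply: (lcomm_radical_chain lP lQ lR aR); rewrite ?of_ // in fkl fs *; lia.
have [eli|li] := eqVneq l i.
  have [x' Px' ->] := params_rev lP ij Px.
  have [y' Qy' ->] := params_rev lQ kl Qy; subst l.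
  apply: (lcomm_radical_chain lP lQ lR aR); rewrite ?of_ //; lia.
have [elj|lj] := eqVneq l (rev_ord j).
  have [y' Qy' ->] := params_rev lQ kl Qy; subst l.
  move: Qy' rkl; rewrite rev_ordK => Qy' rkl.
  apply: (lcomm_radical_chain lP lQ lR aR); rewrite ?of_ // in fkl fs *; lia.
rewrite root_far //; by have [] := radical_subgroup f R.
Qed.

Lemma radical_normalized P k l b : form_ideal P -> k != l -> f l <= f k ->
  params AL k l b -> normalizes (radical f P) (T k l b).
Proof.
move=> fP kl fkl Lb; have lP := form_ideal_level fP.
apply: lconj_generated; first exact: radical_subgroup.
move=> _ [i [j [x [ij fij Px ->]]]]; rewrite lconjE.
have [_ RM _] := radical_subgroup f P; apply: RM; last exact: mem_radical.
apply: (lcomm_radical (form_ideal_level (full_form_ideal A)) lP lP) => //.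
- exact: absorbs_full.
- exact: ltW.
- by rewrite ler_ltD.
Qed.

Lemma radical_normalizes P g : form_ideal P -> radical f AL g ->
  normalizes (radical f P) g.
Proof.
move=> fP; apply: normalizes_generated => _ [i [j [x [ij fij Px ->]]]].
  exists i, j, (- x); split; rewrite ?rootN //.
  exact/paramsN/Px/form_ideal_level/full_form_ideal.
exact: radical_normalized (ltW fij) Px.
Qed.

(** The radical of full level normalises the radical of level [P], so it is
    enough to look at root elements, where the commutator formula applies. *)
Lemma lcomm_radical_Levi P g k l b : form_ideal P -> k != l -> f k = f l ->
  params P k l b -> radical f AL g -> radical f P (lcomm g (T k l b)).
Proof.
move=> fP kl fkl Pb; have lP := form_ideal_level fP; move: g.
apply: lcomm_generated; first exact: radical_subgroup.
  by move=> g; apply: radical_normalizes.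
move=> _ [i [j [x [ij fij Px ->]]]].
apply: (lcomm_radical (form_ideal_level (full_form_ideal A)) lP lP) => //.
- exact: absorbs_full.
- exact: ltW.
- by rewrite fkl.
- by rewrite fkl ltrD2r.
Qed.

End Commutator.


Definition elementary_conjugate (P : set A * set A) : set (G) :=
  [set g | exists i j b a, [/\ i != j, params P i j b, params AL j i a
                             & g = lconj (T j i a) (T i j b)]].

Lemma full_level : level AL.
Proof. exact/form_ideal_level/full_form_ideal. Qed.

Lemma same_root_transv P i j k l x : level P -> i != j -> same_root i j k l ->
  params P i j x -> exists2 y, params P k l y & T i j x = T k l y.
Proof.
move=> lP ij /orP[] /andP[/eqP ei /eqP ej] Px.
  by exists x; rewrite -?ei -?ej.
have [y Py ->] := params_rev lP ij Px.
by move: Py; rewrite ei ej !rev_ordK; exists y.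
Qed.

Lemma transv_comm_far i j k l x y : i != j -> k != l ->
  k != j -> k != rev_ord i -> l != i -> l != rev_ord j ->
  lconj (T i j x) (T k l y) = T k l y.
Proof. by move=> *; rewrite lconjE root_far // mul1g. Qed.

Lemma transv_commute i j k l x y : i != j -> k != l ->
  k != j -> k != rev_ord i -> l != i -> l != rev_ord j ->
  (T i j x * T k l y = T k l y * T i j x)%g.
Proof. by move=> *; rewrite lcomm_swap root_far // mul1g. Qed.

(** * Generation by elementary conjugates *)

Section Generation.
Variable P : set A * set A.
Hypothesis fP : form_ideal P.
Let lP := form_ideal_level fP.
Let H := generated (elementary_conjugate P).

Lemma params_full k l : params P k l `<=` params AL k l.
Proof. by apply: params_mono => //; apply: level_Lam. Qed.

Lemma mem_conjugate i j b a : i != j -> params P i j b -> params AL j i a ->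
  H (lconj (T j i a) (T i j b)).
Proof. by move=> ij Pb La; apply: mem_generated; exists i, j, b, a. Qed.

Lemma mem_transv i j b : i != j -> params P i j b -> H (T i j b).
Proof.
move=> ij Pb; rewrite -[T i j b]lconj1 -(@root0 j i) 1?eq_sym //.
by apply: mem_conjugate => //; case: (params_subgroup j i full_level).
Qed.

Lemma FU_conjugates : rootFU P `<=` H.
Proof.
apply: generated_min; first exact: generated_subgroup.
by move=> _ [i [j [x [ij Px ->]]]]; apply: mem_transv.
Qed.

(** A weight that vanishes at [(i, j)] and is positive at [(k, l)] makes
    [T_kl(c)] an element of the unipotent radical. Moving it across the Levi
    element [T_ji(a)] keeps it there, and its commutator with [T_ij(b)] then
    lies in the radical of level [P], which the Levi element normalises as
    well. *)
Lemma lconj_conjugate_apart i j k l a b c : i != j -> k != l ->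
  ~~ same_root k l i j -> ~~ same_root k l j i ->
  params P i j b -> params AL j i a -> params AL k l c ->
  exists2 u, rootFU P u & lconj (T k l c) (lconj (T j i a) (T i j b)) =
                        (u * lconj (T j i a) (T i j b))%g.
Proof.
move=> ij kl s1 s2 Pb La Lc.
have [f [of_ fij fkl]] := separating_weight kl ij s1 s2.
have ji : j != i by rewrite eq_sym.
pose g := lconj (T j i a)^-1%g (T k l c).
have rg : radical f AL g.
  rewrite /g -rootN //.
  apply: (radical_normalized of_ (full_form_ideal A) ji).
  - by rewrite fij.
  - exact: paramsN full_level La.
  - exact: mem_radical.
exists (lconj (T j i a) (lcomm g (T i j b))).
  apply: (@radical_FU f).
  apply: (radical_normalized of_ fP ji) => //; first by rewrite fij.
  exact: lcomm_radical_Levi.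
rewrite -lconjM -lconjE -!lconjJ; congr (lconj _ _).
by rewrite /g /lconj invgK !mulgA mulgV mul1g.
Qed.

Lemma conj_FU k l c (x : G) : k != l -> params AL k l c -> rootFU P x ->
  H (lconj (T k l c) x).
Proof.
move=> kl Lc; move: x; apply: lconj_generated; first exact: generated_subgroup.
move=> _ [i [j [b [ij Pb ->]]]].
have ji : j != i by rewrite eq_sym.
have [s1|ns1] := boolP (same_root k l i j).
  have [c' Lc' ->] := same_root_transv full_level kl s1 Lc.
  rewrite transv_comm_far ?rev_eqF //; first exact: mem_transv.
have [s2|ns2] := boolP (same_root k l j i).
  have [c' Lc' ->] := same_root_transv full_level kl s2 Lc.
  exact: mem_conjugate.
have L0 : params AL j i 0 by case: (params_subgroup j i full_level).
have [u Fu] := lconj_conjugate_apart ij kl ns1 ns2 Pb L0 Lc.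
rewrite root0 // !lconj1 => ->.
have [_ HM _] : subgroup H by exact: generated_subgroup.
by apply: HM; [apply: FU_conjugates | apply: mem_transv].
Qed.

Lemma mem_conjugate_apart i j k l a b c : i != j -> k != l ->
  ~~ same_root k l i j -> ~~ same_root k l j i ->
  params P i j b -> params AL j i a -> params AL k l c ->
  H (lconj (T k l c) (lconj (T j i a) (T i j b))).
Proof.
move=> ij kl s1 s2 Pb La Lc.
have [u Fu ->] := lconj_conjugate_apart ij kl s1 s2 Pb La Lc.
have [_ HM _] : subgroup H by exact: generated_subgroup.
by apply: HM; [apply: FU_conjugates | apply: mem_conjugate].
Qed.

Let lconj_two_columns i j k u v w : apart i j -> apart k i -> apart k j ->
  P.1 w -> H (lconj (T k i u * T k j v)%g (T j k w)).
Proof.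
move=> /apartE ij /apartE ki /apartE kj Pw; rewrite lconjJ.
by apply: mem_conjugate_apart;
  rewrite ?params_short /same_root ?rev_eq ?ij ?ki ?kj ?andbF.
Qed.

(** With a third index, [T_ij(b)] is the commutator of [T_ik(b)] and
    [T_kj(1)]. Under the two conjugations the former stays in column [k] with
    level [P] and the latter in row [k]. Conjugating an element of column [k]
    by one of row [k] gives an elementary conjugate, acted on by one more root
    element at a root that is not proportional. *)
Let lconj_same_short i j a b c : (3 <= n)%N -> apart i j ->
  P.1 b -> H (lconj (T i j c) (lconj (T j i a) (T i j b))).
Proof.
move=> hn aij Pb; have [k aki akj] := exists_apart i j hn.
have [aji aik ajk] : [/\ apart j i, apart i k & apart j k].
  by rewrite ![apart _ k]apartC apartC.
have /apartE ij := aij; have /apartE ki := aki; have /apartE kj := akj.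
have [_ HM HV] : subgroup H by exact: generated_subgroup.
rewrite -[b]mulr1 -(@root_chain _ k) // !lconj_lcomm.
have -> : lconj (T i j c) (lconj (T j i a) (T k j 1)) =
          (T k i (- a) * T k j (a * c + 1))%g.
  rewrite [lconj (T j i a) _]lconjE -lcommV root_chain //.
  rewrite -rootN ?ki // mul1r lconjM [lconj _ (T k i _)]lconjE -lcommV.
  rewrite root_chain // -rootN ?kj // mulNr opprK.
  rewrite transv_comm_far ?ij ?kj ?ki ?rev_eqF //.
  rewrite [X in (X * _)%g]transv_commute ?ki ?kj ?rev_eqF // 1?rev_eqC ?ij //.
  by rewrite -mulgA -rootD ?kj.
have -> : lconj (T i j c) (lconj (T j i a) (T i k b)) =
   (T i k (c * (a * b)) * T j k (a * b) * T i k b)%g.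
  rewrite [lconj (T j i a) _]lconjE root_chain // lconjM.
  rewrite [lconj (T i j c) (T j k _)]lconjE root_chain //.
  by rewrite transv_comm_far ?ij ?ki ?kj ?rev_eqF.
have Pab := (level_ideal lP a Pb).1; have Pcab := (level_ideal lP c Pab).1.
set u := - a; set v := a * c + 1.
have Hj w : P.1 w -> H (lconj (T k i u * T k j v) (T j k w)).
  exact: lconj_two_columns.
have Hi w : P.1 w -> H (lconj (T k i u * T k j v) (T i k w)).
  rewrite transv_commute ?ki ?kj ?rev_eqF // 1?rev_eqC ?ij //.
  exact: lconj_two_columns.
rewrite lcomm_lconjr lconjV !lconjM.
apply: (HM); [apply: (HM); [apply: (HM)|] |
  apply: HV; apply: (HM); [apply: (HM)|]]; auto;
  by apply: mem_transv; rewrite ?params_short ?ki ?kj.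
Qed.

Lemma lconj_long_short i m c u : apart m i -> params AL i (rev_ord i) c ->
  exists w v, params AL m (rev_ord m) w /\
    lconj (T i (rev_ord i) c) (T m i u) =
    (T m (rev_ord m) w * T m (rev_ord i) v * T m i u)%g.
Proof.
move=> ami Lc; exists (- (u * c * star m i u)), (- (u * c)); split.
  apply: paramsN full_level _.
  exact: (long_conj _ (absorbs_full (full_form_ideal A)) _ Lc).
have /apartE mi := ami.
rewrite lconjE -lcommV root_long ?(long_star full_level Lc) // invgM.
by rewrite !rootN ?rev_eqF // mi.
Qed.

(** The long root elements are central here and absorb the commutators of the
    short ones, so these products in fixed order form a group. Conjugation by
    the root elements at [(i, -i)] and [(-i, i)] preserves it. *)
Definition heisenberg m i : set (G) :=
  [set h | exists u v w, params AL m (rev_ord m) w /\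
     h = (T m i u * T m (rev_ord i) v * T m (rev_ord m) w)%g].

Lemma heisenberg1 m i : apart m i -> heisenberg m i 1%g.
Proof.
move=> /apartE mi; exists 0, 0, 0; split.
  by case: (params_subgroup m (rev_ord m) full_level).
by rewrite !root0 ?mi ?rev_eqF // !mulg1.
Qed.

Lemma heisenberg_mul1 m i u h : apart m i ->
  heisenberg m i h -> heisenberg m i (T m i u * h)%g.
Proof.
move=> /apartE mi [u' [v [w [Lw ->]]]]; exists (u + u'), v, w; split=> //.
by rewrite rootD ?mi // !mulgA.
Qed.

Lemma heisenberg_mul3 m i w h : apart m i -> params AL m (rev_ord m) w ->
  heisenberg m i h -> heisenberg m i (T m (rev_ord m) w * h)%g.
Proof.
move=> /apartE mi Lw [u [v [w' [Lw' ->]]]]; exists u, v, (w + w').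
split; first exact: paramsD full_level Lw Lw'.
rewrite rootD ?rev_eqF // !mulgA.
rewrite [(T m _ w * T m i u)%g]transv_commute ?rev_ordK ?mi ?rev_eqF //.
congr (_ * _)%g; rewrite -!mulgA; congr (_ * _)%g.
by apply: transv_commute; rewrite ?(rev_ordK, rev_eq, rev_eqC, mi, rev_eqF).
Qed.

Lemma heisenberg_mul2 m i v h : apart m i ->
  heisenberg m i h -> heisenberg m i (T m (rev_ord i) v * h)%g.
Proof.
move=> ami [u [v' [w [Lw ->]]]]; have /apartE mi := ami.
have [w' Lw' e] : exists2 w', params AL m (rev_ord m) w' &
    lcomm (T m (rev_ord i) v) (T m i u) = T m (rev_ord m) w'.
  have es := @root_rev m i u; rewrite es ?mi //.
  have ami' : apart m (rev_ord i) by rewrite apart_revr.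
  rewrite (root_short v _ ami').
  eexists; last reflexivity.
  exact: long_trace full_level I.
rewrite !mulgA [(_ * T m i u)%g]lcomm_swap e -!mulgA.
apply: heisenberg_mul3 => //.
exists u, (v + v'), w; split=> //.
by rewrite rootD ?mi // !mulgA.
Qed.

Lemma heisenberg_lconj m i h b : apart m i -> heisenberg m i h ->
  params P (rev_ord m) m b -> H (lconj h (T (rev_ord m) m b)).
Proof.
move=> /apartE mi [u [v [w [Lw ->]]]] Pb; rewrite !lconjJ.
have [_ HM _] : subgroup H by exact: generated_subgroup.
have Lu : params AL m i u by rewrite params_short ?mi.
have Lv : params AL m (rev_ord i) v by rewrite params_short ?rev_eq ?mi.
have [U FU ->] : exists2 U, rootFU P U &
    lconj (T m (rev_ord i) v) (lconj (T m (rev_ord m) w) (T (rev_ord m) m b)) =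
    (U * lconj (T m (rev_ord m) w) (T (rev_ord m) m b))%g.
  apply: lconj_conjugate_apart;
    rewrite /same_root ?(rev_ordK, rev_eq, rev_eqC, mi, rev_eqF, andbF) //.
rewrite lconjM; apply: HM.
  by apply: conj_FU; rewrite ?mi.
apply: mem_conjugate_apart;
  rewrite /same_root ?(rev_ordK, rev_eq, rev_eqC, mi, rev_eqF, andbF) //.
Qed.

Lemma heisenberg_Levi m i a c u : apart m i ->
  params AL (rev_ord i) i a -> params AL i (rev_ord i) c ->
  heisenberg m i (lconj (T i (rev_ord i) c)
    (lconj (T (rev_ord i) i a) (T m (rev_ord i) u))).
Proof.
move=> ami La Lc; have /apartE mi := ami.
have ami' : apart m (rev_ord i) by rewrite apart_revr.
have := @lconj_long_short (rev_ord i) m a u ami'.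
rewrite rev_ordK => /(_ La)[w [v [Lw ->]]]; rewrite !lconjM.
have [w' [v' [Lw' ->]]] := lconj_long_short v ami Lc.
rewrite !transv_comm_far ?(rev_ordK, rev_eq, rev_eqC, mi, rev_eqF) //.
rewrite -!mulgA; do 2![apply: heisenberg_mul3 => //].
apply: heisenberg_mul2 => //; apply: heisenberg_mul1 => //.
rewrite -[T m (rev_ord i) u]mulg1; apply: heisenberg_mul2 => //.
exact: heisenberg1.
Qed.

(** Up to a factor in the unipotent radical for the weight of [k], the element
    [T_(i, -i)(b)] is the commutator of [T_ik(1)] with a long root element at
    [(k, -k)]. The latter is fixed by the two conjugations and the former
    moves inside a Heisenberg group, which acts well on root elements at [(k,
    -k)]. *)
Let lconj_same_long i a b c : (3 <= n)%N -> params P i (rev_ord i) b ->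
  params AL (rev_ord i) i a -> params AL i (rev_ord i) c ->
  H (lconj (T i (rev_ord i) c)
       (lconj (T (rev_ord i) i a) (T i (rev_ord i) b))).
Proof.
move=> hn Pb La Lc; have [k aki _] := exists_apart i i hn.
have [_ HM HV] : subgroup H by exact: generated_subgroup.
have /apartE ki := aki; have aik : apart i k by rewrite apartC.
(* Chosen so that [b' * star i k 1 = b]. *)
pose b' := 1 * b * star k i 1.
have Pb' : params P k (rev_ord k) b' by exact: long_conj (absorbs_full fP) I Pb.
have eb : T i (rev_ord i) b =
    ((T i (rev_ord k) (1 * b'))^-1 * lcomm (T i k 1) (T k (rev_ord k) b'))%g.
  rewrite root_long ?(long_star lP Pb') // mulKg; congr (T _ _ _).
  by rewrite /b' !mul1r -mulrA -(starM i k) mulr1 star_id bar1 mulr1.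
rewrite eb [lconj (T (rev_ord i) i a) _]lconjM.
rewrite [lconj (T i (rev_ord i) c) _]lconjM; apply: (HM).
  rewrite -rootN ?(rev_eq, rev_eqC, ki) //; apply: FU_conjugates.
  have ci : dirac_weight k i = 0 by rewrite dirac_weight_apart.
  have ci' : dirac_weight k (rev_ord i) = 0.
    by rewrite dirac_weight_apart ?apart_revr.
  have iri : i != rev_ord i by rewrite rev_eqF.
  have of_ := @dirac_weight_odd n k; apply: (@radical_FU (dirac_weight k)).
  apply: (radical_normalized of_ fP iri) => //; first by rewrite ci ci'.
  apply: (radical_normalized of_ fP (rev_ord_neq i)) => //.
    by rewrite ci ci'.
  apply: mem_radical; rewrite ?ki //.
    by rewrite dirac_weight_odd dirac_weight_id ci.
  apply: paramsN lP _; rewrite params_short ?rev_eq ?ki //.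
  exact: (level_ideal lP 1 (params_incl lP Pb')).1.
rewrite !lconj_lcomm [lconj _ (T k _ _)]transv_comm_far;
  rewrite ?(rev_ordK, rev_eq, rev_eqC, ki, rev_eqF) //.
rewrite [lconj _ (T k _ _)]transv_comm_far;
  rewrite ?(rev_ordK, rev_eq, rev_eqC, ki, rev_eqF) //.
set h := lconj _ (lconj _ (T i k 1)).
rewrite [lcomm h _]lcomm_lconjl -rootN ?rev_eqF //; apply: (HM); last first.
  by apply: mem_transv; rewrite ?rev_eqF //; apply: paramsN lP _.
have hh : heisenberg (rev_ord k) i h.
  rewrite /h (@root_rev i k 1) ?ki //; apply: heisenberg_Levi => //.
  by rewrite apart_revl.
have := @heisenberg_lconj (rev_ord k) i h b'.
by rewrite rev_ordK apart_revl; apply.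
Qed.

(** The only position of the roots that no weight separates and that is not
    absorbed into the conjugating element. The remedy is to write [T_ij(b)] as
    a commutator of elements at other roots, one of them of level [P]; this
    needs [n >= 3] for short roots. *)
Lemma mem_conjugate_same i j a b c : (3 <= n)%N -> i != j -> params P i j b ->
  params AL j i a -> params AL i j c ->
  H (lconj (T i j c) (lconj (T j i a) (T i j b))).
Proof.
move=> hn ij Pb La Lc; have [ej|nj] := eqVneq j (rev_ord i).
  by subst j; apply: lconj_same_long.
apply: lconj_same_short => //; first by rewrite /apart ij -rev_eqC eq_sym.
by move: Pb; rewrite params_short.
Qed.

Lemma mem_conjugate_root k l c : (3 <= n)%N -> k != l -> params AL k l c ->
  normalizes H (T k l c).
Proof.
move=> hn kl Lc; apply: lconj_generated; first exact: generated_subgroup.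
move=> _ [i [j [b [a [ij Pb La ->]]]]]; have ji : j != i by rewrite eq_sym.
have [s1|ns1] := boolP (same_root k l i j).
  have [c' Lc' ->] := same_root_transv full_level kl s1 Lc.
  exact: mem_conjugate_same.
have [s2|ns2] := boolP (same_root k l j i).
  have [c' Lc' ->] := same_root_transv full_level kl s2 Lc.
  rewrite -lconjJ -rootD //; apply: mem_conjugate => //.
  exact: paramsD full_level _ _.
exact: mem_conjugate_apart.
Qed.

Lemma conjugates_normal : (3 <= n)%N -> normal_subgroup (rootFU AL) H.
Proof.
move=> hn; have [F1 FM FV] : subgroup (rootFU AL) by exact: generated_subgroup.
split; first exact: generated_subgroup.
  apply: generated_min; first exact: generated_subgroup.
  move=> _ [i [j [b [a [ij Pb La ->]]]]]; have ji : j != i by rewrite eq_sym.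
  apply: (FM); last by apply: FV; apply: mem_rootFU.
  apply: (FM); first exact: mem_rootFU.
  by apply: mem_rootFU => //; apply: params_full.
move=> g h Eg; move: h; apply: normalizes_generated Eg.
  move=> _ [i [j [x [ij Lx ->]]]]; exists i, j, (- x).
  by rewrite rootN //; split=> //; apply: paramsN full_level _.
by move=> _ [i [j [x [ij Lx ->]]]]; apply: mem_conjugate_root.
Qed.

(** The group generated by the conjugates is normalised by every root element,
    whether its root is equal, opposite or not proportional to the one of the
    conjugate. *)
Lemma rootEU_conjugates : (3 <= n)%N -> rootEU P `<=` H.
Proof.
move=> hn; apply: smallest_sub; first exact: conjugates_normal.
exact: FU_conjugates.
Qed.

End Generation.

Lemma rootFU_full P : form_ideal P -> rootFU P `<=` rootFU AL.
Proof.
move=> fP; apply: generated_mono => _ [i [j [x [ij Px ->]]]].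
by exists i, j, x; split=> //; apply: params_full Px.
Qed.

Lemma rootEU_normal P : form_ideal P -> normal_subgroup (rootFU AL) (rootEU P).
Proof.
move=> fP; apply: normal_closure_normal; first exact: generated_subgroup.
exact: rootFU_full.
Qed.

Lemma mem_rootEU P i j x : i != j -> params P i j x -> rootEU P (T i j x).
Proof. by move=> ij Px; apply: sub_gen_smallest; apply: mem_rootFU. Qed.

Definition root_in (E : set G) i j : set A :=
  [set x | params AL i j x /\ E (T i j x)].

Lemma mem_root_in P i j x : form_ideal P -> i != j -> params P i j x ->
  root_in (rootEU P) i j x.
Proof.
by move=> fP ij Px; split; [apply: params_full Px | apply: mem_rootEU].
Qed.

(** * Root elements of product level as commutators *)

Section Products.
Variables (C : set G) (P Q : set A * set A).
Hypotheses (sC : subgroup C) (lQ : level Q) (hn : (3 <= n)%N).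
Hypothesis hC : forall x y : G, rootEU P x -> rootEU Q y -> C (lcomm x y).

Lemma mem_product_short i j x y : apart i j -> P.1 x -> Q.1 y ->
  C (T i j (x * y)).
Proof.
move=> aij Px Qy; have [k aki akj] := exists_apart i j hn.
have aik : apart i k by rewrite apartC.
have /apartE ki := aki; have /apartE kj := akj.
rewrite -(@root_chain i k j) //.
by apply: hC; apply: mem_rootEU; rewrite ?params_short ?ki ?kj.
Qed.

Lemma mem_product_trace i x y : P.1 x -> Q.1 y ->
  C (T i (rev_ord i) (x * y - star i (rev_ord i) (x * y))).
Proof.
move=> Px Qy; have [k aki _] := exists_apart i i hn.
have aik : apart i k by rewrite apartC.
have /apartE ki := aki; rewrite -(@root_short i k) //.
by apply: hC; apply: mem_rootEU;
  rewrite ?params_short ?(rev_eq, rev_eqC, rev_ordK, ki).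
Qed.

Lemma mem_product_conj i k x y :
  apart i k -> P.1 x -> params Q k (rev_ord k) y ->
  C (T i (rev_ord i) (x * y * star i k x)).
Proof.
move=> aik Px Qy; have /apartE ik := aik; have [_ CM CV] := sC.
rewrite -[T i (rev_ord i) _](mulKg (T i (rev_ord k) (x * y))).
rewrite -root_long ?(long_star lQ Qy) //; apply: CM.
  apply: CV; apply: mem_product_short => //; first by rewrite apart_revr.
  exact: params_incl lQ _ Qy.
by apply: hC; apply: mem_rootEU; rewrite ?rev_eqF ?ik // params_short ?ik.
Qed.


Lemma mem_product_Lam i x y : P.1 x -> Q.2 y ->
  C (T i (rev_ord i) (lam_half i * (x * y * bar x))).
Proof.
move=> Px Qy; have [k aki _] := exists_apart i i hn.
have aik : apart i k by rewrite apartC.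
have Qy' : params Q k (rev_ord k) (lam_half k * y).
  by apply/params_long; rewrite mulrA bar_lam_halfK mul1r.
by rewrite (@lam_half_conj A n i k); apply: mem_product_conj.
Qed.

End Products.

(** The parameters of the product are sums of traces and of [x y (bar x)] with
    factors from the two form ideals, each of which occurs in a commutator
    relation. The generators [z y (bar z)] with [z] in the product ideal and
    [y] in [Lam] are quadratic in [z]: the cross terms are traces, and for [z
    = u v] the inner factor [v y (bar v)] already belongs to a relative form
    parameter. *)
Lemma mem_product P Q i j x (C : set G) : form_ideal P -> form_ideal Q ->
  (3 <= n)%N -> subgroup C ->
  (forall x y : G, rootEU P x -> rootEU Q y -> C (lcomm x y)) ->
  i != j -> params (form_ideal_mul P Q) i j x -> C (T i j x).
Proof.
move=> fP fQ hn sC hPQ ij; have [C1 CM CV] := sC.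
have hQP (y z : G) : rootEU Q y -> rootEU P z -> C (lcomm y z).
  by move=> Qy Pz; rewrite -lcommV; apply/CV/hPQ.
have lP := form_ideal_level fP; have lQ := form_ideal_level fQ.
have lK := product_level fP fQ.
have CB i' j' y z : i' != j' -> C (T i' j' y) -> C (T i' j' z) ->
    C (T i' j' (y - z)).
  by move=> ij' Cy Cz; rewrite rootD // rootN //; apply: CM => //; apply: CV.
have [ej|nj] := eqVneq j (rev_ord i); last first.
  have aij : apart i j by rewrite /apart ij -rev_eqC eq_sym.
  rewrite params_short //; move: x.
  have sE : additive_subgroup [set y | C (T i j y)].
    by split=> [|y z Cy Cz] /=; [rewrite root0 | apply: CB].
  apply: (@set_add_min _ _ _ [set y | C (T i j y)]) => //;
      apply: additive_span_min => // _ [y Py [z Qz <-]].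
    exact: (mem_product_short hn hPQ).
  exact: (mem_product_short hn hQP).
subst j; set K := form_ideal_mul P Q => /params_long Kx.
pose D := [set y | C (T i (rev_ord i) (lam_half i * y))].
suff: K.2 `<=` D by move=> /(_ _ Kx); rewrite /D /= mulrA lam_halfK mul1r.
have sD : additive_subgroup D.
  by split=> [|y z Dy Dz]; rewrite /D /= ?mulr0 ?root0 // mulrBr; apply: CB.
have trD z : K.1 z -> D (z - lam A * bar z).
  move=> Kz; rewrite /D /= mulrBr -star_lam_half.
  have := (level_ideal lK (lam_half i) Kz).1; move: (lam_half i * z) => {z Kz}.
  have sE : additive_subgroup
      [set z | C (T i (rev_ord i) (z - star i (rev_ord i) z))].
    split=> [|y z Cy Cz] /=; first by rewrite starE bar0 mulr0 subrr root0.
    have -> : y - z - star i (rev_ord i) (y - z) =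
        y - star i (rev_ord i) y - (z - star i (rev_ord i) z).
      by rewrite starB !opprB addrACA [RHS]addrACA [- z - _]addrC.
    by apply: CB; rewrite ?rev_eqF.
  apply: (@set_add_min _ _ _
      [set z | C (T i (rev_ord i) (z - star i (rev_ord i) z))]) => //;
    apply: additive_span_min => // _ [y Py [z Qz <-]].
    exact: (mem_product_trace hn hPQ).
  exact: (mem_product_trace hn hQP).
apply: set_add_min => //; first apply: set_add_min => //;
    first apply: set_add_min => //.
- by move=> _ [z Kz <-]; apply: trD.
- apply: additive_span_min => // _ [z Kz [y Ly <-]].
  pose E := [set z | K.1 z /\ D (z * y * bar z)].
  suff: K.1 `<=` E by move=> /(_ z Kz)[].
  have [_ _ maxL _] := LamP A.
  have ey : y = - (lam A * bar y) := maxL y Ly.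
  have sE : additive_subgroup E.
    have [K0 KB] := level_sub1 lK.
    split=> [|u v [Ku Du] [Kv Dv]]; first by rewrite /E /= !mul0r; case: sD.
    split; first exact: KB.
    (* The cross terms of the quadratic map form a trace. *)
    have e : v * y * bar u = - (lam A * bar (u * y * bar v)).
      rewrite !barM barK {1}ey mulrN mulNr; congr (- _).
      by rewrite !mulrA lam_central.
    have -> : (u - v) * y * bar (u - v) = u * y * bar u + v * y * bar v -
        (u * y * bar v - lam A * bar (u * y * bar v)).
      by rewrite barB mulrBr !mulrBl e opprK !opprB addrACA.
    apply: (sD.2); first exact: additive_subgroupD.
    by apply: trD; rewrite -mulrA; apply: (level_ideal lK _ Ku).2.
  have aK := product_absorbs fP fQ.
  apply: set_add_min => //; apply: additive_span_min => // _ [u Pu [v Qv <-]].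
    split; first exact: (absorbs_mul aK Pu Qv).1.
    have -> : u * v * y * bar (u * v) = u * (v * y * bar v) * bar u.
      by rewrite barM !mulrA.
    apply: (mem_product_Lam sC lQ hn hPQ) => //.
    by apply: (absorbs_conjC (absorbs_full fQ)).
  split; first exact: (absorbs_mul aK Qv Pu).2.
  have -> : u * v * y * bar (u * v) = u * (v * y * bar v) * bar u.
    by rewrite barM !mulrA.
  apply: (mem_product_Lam sC lP hn hQP) => //.
  by apply: (absorbs_conjC (absorbs_full fP)).
- apply: additive_span_min => // _ [z Qz [y Py <-]].
  exact: (mem_product_Lam sC lP hn hQP).
- apply: additive_span_min => // _ [z Pz [y Qy <-]].
  exact: (mem_product_Lam sC lQ hn hPQ).
Qed.

(** * The mixed commutator subgroup *)

Section Main.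
Variables P Q : set A * set A.
Hypotheses (fP : form_ideal P) (fQ : form_ideal Q) (hn : (3 <= n)%N).
Let K := form_ideal_mul P Q.
Let E := rootFU AL.

Definition mixed_generators : set G :=
  [set g | exists i j (c : G) (alpha a beta : A),
     [/\ i != j, E c, root_in (rootEU P) j i alpha, root_in E i j a
       & root_in (rootEU Q) j i beta] /\
     g = lconj c (lcomm (T j i alpha) (lconj (T i j a) (T j i beta)))]
  `|`
  [set g | exists i j (c : G) (alpha beta : A),
     [/\ i != j, E c, root_in (rootEU P) j i alpha
       & root_in (rootEU Q) i j beta] /\
     g = lconj c (lcomm (T j i alpha) (T i j beta))]
  `|`
  [set g | exists i j (c : G) (xi : A),
     [/\ i != j, E c & root_in (rootEU K) i j xi] /\ g = lconj c (T i j xi)].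

Let M := generated mixed_generators.
Let C := mixed_commutator (rootEU P) (rootEU Q).

Let sE : subgroup E. Proof. exact: generated_subgroup. Qed.

Let E1 : E 1%g. Proof. by case: sE. Qed.

Let EM c d : E c -> E d -> E (c * d)%g. Proof. by case: sE => _ + _; apply. Qed.

Lemma mixed_generators_normal c : E c -> normalizes M c.
Proof.
move=> Ec; apply: lconj_generated; first exact: generated_subgroup.
move=> g [[]|] Mg; apply: mem_generated.
- have [i [j [d [x [a [y [[ij Ed Px La Qy] ->]]]]]]] := Mg.
  by left; left; exists i, j, (c * d)%g, x, a, y; rewrite lconjJ; split=> //;
    split=> //; apply: EM.
- have [i [j [d [x [y [[ij Ed Px Qy] ->]]]]]] := Mg.
  by left; right; exists i, j, (c * d)%g, x, y; rewrite lconjJ; split=> //;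
    split=> //; apply: EM.
- have [i [j [d [x [[ij Ed Kx] ->]]]]] := Mg.
  by right; exists i, j, (c * d)%g, x; rewrite lconjJ; split=> //;
    split=> //; apply: EM.
Qed.

Lemma mem_conjugate_commutator i j x a y : i != j -> params P i j x ->
  params AL j i a -> params Q i j y ->
  M (lcomm (T i j x) (lconj (T j i a) (T i j y))).
Proof.
move=> ij Px La Qy; have ji : j != i by rewrite eq_sym.
apply: mem_generated; left; left; exists j, i, 1%g, x, a, y; rewrite lconj1.
split=> //; split=> //; try exact: mem_root_in.
by split=> //; apply: mem_rootFU.
Qed.

Lemma mem_opposite_commutator i j x y : i != j -> params P j i x ->
  params Q i j y -> M (lcomm (T j i x) (T i j y)).
Proof.
move=> ij Px Qy; have ji : j != i by rewrite eq_sym.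
apply: mem_generated; left; right; exists i, j, 1%g, x, y; rewrite lconj1.
by split=> //; split=> //; apply: mem_root_in.
Qed.

Lemma product_FU : rootFU K `<=` M.
Proof.
have lK := product_level fP fQ.
apply: generated_min; first exact: generated_subgroup.
move=> _ [i [j [x [ij Kx ->]]]]; apply: mem_generated; right.
exists i, j, 1%g, x; rewrite lconj1; split=> //; split=> //.
split; last exact: mem_rootEU.
by apply: params_mono Kx => //; apply: level_Lam.
Qed.

(** The commutator formula leaves only root elements of level [P o Q], which
    are generators of the third kind. *)
Lemma lcomm_radical_mixed f i j y g : odd_weight f -> i != j -> f i = f j ->
  params Q i j y -> radical f P g -> M (lcomm g (T i j y)).
Proof.
move=> of_ ij fij Qy; move: g; apply: lcomm_generated.
- exact: generated_subgroup.
- move=> g rg; apply: mixed_generators_normal.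
  by apply: (rootFU_full fP); apply: (@radical_FU f).
move=> _ [k [l [x [kl fkl Px ->]]]]; apply: product_FU; apply: (@radical_FU f).
apply: (lcomm_radical of_ (form_ideal_level fP) (form_ideal_level fQ)
  (product_level fP fQ) (product_absorbs fP fQ)) => //.
- exact: ltW.
- by rewrite fij.
- by rewrite fij ltrD2r.
Qed.

(** For equal or opposite roots this is a generator of the first or second
    kind. Otherwise a weight puts [T_kl(x)], even after conjugation by [T_ji(-
    a)], in a unipotent radical with [T_ij(y)] in the Levi subgroup. *)
Lemma lcomm_root_conjugate k l i j x a y : k != l -> i != j ->
  params P k l x -> params AL j i a -> params Q i j y ->
  M (lcomm (T k l x) (lconj (T j i a) (T i j y))).
Proof.
move=> kl ij Px La Qy; have ji : j != i by rewrite eq_sym.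
have Et : E (T j i a) by apply: mem_rootFU.
have lP := form_ideal_level fP.
have [s1|ns1] := boolP (same_root k l i j).
  have [x' Px' ->] := same_root_transv lP kl s1 Px.
  exact: mem_conjugate_commutator.
rewrite -[T k l x](lconjVK (T j i a)) -lconj_lcomm.
apply: mixed_generators_normal => //.
have [s2|ns2] := boolP (same_root k l j i).
  have [x' Px' ->] := same_root_transv lP kl s2 Px.
  rewrite -rootN // transv_comm_far ?rev_eqF //.
  exact: mem_opposite_commutator.
have [f [of_ fij fkl]] := separating_weight kl ij ns1 ns2.
apply: (@lcomm_radical_mixed f) => //; rewrite -rootN //.
apply: (radical_normalized of_ fP ji); first by rewrite fij.
  exact: paramsN full_level La.
exact: mem_radical.
Qed.

(** Both relative groups are generated by conjugates of root elements, and
    conjugation can be moved from one side of a commutator to the other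
    because [M] and the relative groups are normal in the absolute one. *)
Lemma mixed_commutator_sub : C `<=` M.
Proof.
have sM : subgroup M by exact: generated_subgroup.
have [_ _ MV] := sM.
apply: generated_min => // _ [x EPx [y EQy <-]].
have conjE R g : form_ideal R -> generated (elementary_conjugate R) g -> E g.
  by move=> fR Rg; have [_ sub _] := conjugates_normal fR hn; apply: sub.
have root_EU k l u z : k != l -> params P k l u -> rootEU Q z ->
    M (lcomm (T k l u) z).
  move=> kl Pu /(rootEU_conjugates fQ hn) Qz; rewrite -lcommV; apply: (MV).
  move: z Qz; apply: lcomm_generated => //.
    by move=> g Qg; apply: mixed_generators_normal; apply: (conjE Q).
  move=> _ [i [j [b [a [ij Qb La ->]]]]]; rewrite -lcommV; apply: (MV).
  exact: lcomm_root_conjugate.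
move: EPx => /(rootEU_conjugates fP hn); move: x.
apply: lcomm_generated => //.
  by move=> g Pg; apply: mixed_generators_normal; apply: (conjE P).
move=> _ [i [j [b [a [ij Pb La ->]]]]]; have ji : j != i by rewrite eq_sym.
rewrite -[y](lconjVK (T j i a)) -lconj_lcomm.
apply: mixed_generators_normal; first exact: mem_rootFU.
apply: root_EU => //; have [_ _ nQ] := rootEU_normal fQ; apply: nQ => //.
by rewrite -rootN //; apply: mem_rootFU => //; apply: paramsN full_level La.
Qed.

Lemma mixed_commutator_normal c : E c -> normalizes C c.
Proof.
move=> Ec; have [[_ _ nP] [_ _ nQ]] := (rootEU_normal fP, rootEU_normal fQ).
apply: lconj_generated; first exact: generated_subgroup.
move=> _ [x Px [y Qy <-]]; apply: mem_generated; rewrite lconj_lcomm.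
by exists (lconj c x); [exact: nP | exists (lconj c y); [exact: nQ |]].
Qed.

Lemma mixed_commutator_gen : mixed_generators `<=` C.
Proof.
have sC : subgroup C by exact: generated_subgroup.
have CPQ (x y : G) : rootEU P x -> rootEU Q y -> C (lcomm x y).
  by move=> Px Qy; apply: mem_generated; exists x => //; exists y.
have [[sEP subP nP] [_ _ nQ]] := (rootEU_normal fP, rootEU_normal fQ).
move=> g [[]|].
- move=> [i [j [c [x [a [y [[ij Ec [_ Px] [_ Ea] [_ Qy]] ->]]]]]]].
  by apply: mixed_commutator_normal => //; apply: CPQ => //; apply: nQ.
- move=> [i [j [c [x [y [[ij Ec [_ Px] [_ Qy]] ->]]]]]].
  by apply: mixed_commutator_normal => //; apply: CPQ.
- move=> [i [j [c [x [[ij Ec [_ Kx]] ->]]]]].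
  apply: mixed_commutator_normal => //; move: Kx; apply: smallest_sub.
    split=> //.
      apply: generated_min; first exact: generated_subgroup.
      move=> _ [u /subP Eu [v Qv <-]]; have [_ subQ _] := rootEU_normal fQ.
      have [_ _ EV] := sE.
      rewrite /lcomm.
      by do ![apply: EM => //]; try apply: EV => //; apply: subQ.
    by move=> d y Ed; apply: mixed_commutator_normal.
  apply: generated_min => // _ [k [l [u [kl Ku ->]]]].
  exact: (mem_product fP fQ hn sC CPQ).
Qed.

Theorem mixed_commutator_generated : C = M.
Proof.
apply/seteqP; split; first exact: mixed_commutator_sub.
apply: generated_min; first exact: generated_subgroup.
exact: mixed_commutator_gen.
Qed.

End Main.

End Chevalley.

Theorem theorem9 (A : formRing) (n : nat) (hn : (3 <= n)%N)
    (I Gamma J Delta : set A)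
    (hI : form_ideal (I, Gamma)) (hJ : form_ideal (J, Delta)) :
  mixed_commutator (EU n (I, Gamma)) (EU n (J, Delta)) =
  generated
    ([set g | exists (i j : 'I_(2 * n)) (c : GL A (2 * n)) (alpha a beta : A),
        [/\ i != j, EU_abs A n c,
            transv_in (EU n (I, Gamma)) j i alpha,
            transv_in (EU_abs A n) i j a
          & transv_in (EU n (J, Delta)) j i beta] /\
        g = lconj c (lcomm (transv j i alpha)
                           (lconj (transv i j a) (transv j i beta)))]
     `|`
     [set g | exists (i j : 'I_(2 * n)) (c : GL A (2 * n)) (alpha beta : A),
        [/\ i != j, EU_abs A n c,
            transv_in (EU n (I, Gamma)) j i alpha
          & transv_in (EU n (J, Delta)) i j beta] /\
        g = lconj c (lcomm (transv j i alpha) (transv i j beta))]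
     `|`
     [set g | exists (i j : 'I_(2 * n)) (c : GL A (2 * n)) (xi : A),
        [/\ i != j, EU_abs A n c
          & transv_in (EU n (form_ideal_mul (I, Gamma) (J, Delta))) i j xi] /\
        g = lconj c (transv i j xi)]).
Proof.
exact: (mixed_commutator_generated (@transv_steinberg A n) hI hJ hn).
Qed.
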